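(* Let $G$ be a directed monotone $\sigma$-complete po-group with interpolation, and let $E=\Gamma_{ea}(\mathbb Z\,\overrightarrow{\times}\,G,(1,0))$ be the corresponding perfect effect algebra. Then every two-dimensional spectral resolution $F:\mathbb R^2\to E$ can be extended to a unique two-dimensional observable on $E$, i.e. there is a unique two-dimensional observable $x$ on $E$ with $x((-\infty,s)\times(-\infty,t))=F(s,t)$ for all $(s,t)\in\mathbb R^2$.
   Context: All groups are Abelian and written additively. A po-group $G$ is monotone $\sigma$-complete if every non-decreasing sequence in $G$ bounded above has a supremum in $G$; it has interpolation if whenever $a_1,a_2\le b_1,b_2$ in $G$ there is $c\in G$ with $a_1,a_2\le c\le b_1,b_2$. $\mathbb Z\,\overrightarrow{\times}\,G$ is $\mathbb Z\times G$ with lexicographic order: $(m,g)\le(m',g')$ iff $m<m'$, or $m=m'$ and $g\le g'$. $\Gamma_{ea}(\mathbb Z\,\overrightarrow{\times}\,G,(1,0))$ is the interval effect algebra $[(0,0),(1,0)]$, in which $a+b$ is the group sum, defined when it is $\le(1,0)$; its bottom is $0=(0,0)$ and its top is $1=(1,0)$. $\mathrm{Rad}(E)=\{(0,g):g\ge 0\}$ and $\mathrm{Rad}(E)'=\{(1,-g): g\ge0\}$; $E$ is their disjoint union. Suprema and infima below are taken in $E$. A two-dimensional spectral resolution on $E$ is a map $F:\mathbb R^2\to E$ such that: (i) (volume condition) for all reals $a_1\le b_1$, $a_2\le b_2$, $F(b_1,b_2)-F(a_1,b_2)-F(b_1,a_2)+F(a_1,a_2)\ge0$, computed in $\mathbb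 Z\,\overrightarrow{\times}\,G$; (ii) $\bigvee_{s_1<t_1,\,s_2<t_2}F(s_1,s_2)=F(t_1,t_2)$ for all $(t_1,t_2)\in\mathbb R^2$; (iii) $\bigwedge_{t\in\mathbb R}F(t,s)=0=\bigwedge_{t\in\mathbb R}F(s,t)$ for all $s\in\mathbb R$; (iv) $\bigvee_{(s_1,s_2)\in\mathbb R^2}F(s_1,s_2)=1$; (v) if $(s_0,t_0)$ denotes the characteristic point of $F$, i.e. the coordinatewise infimum of $T_1=\{(s,t)\in\mathbb R^2: F(s,t)\in\mathrm{Rad}(E)'\}$, then $\bigwedge\{F(s,t): s>s_0,\ t>t_0\}$ exists in $E$ and belongs to $\mathrm{Rad}(E)'$. A two-dimensional observable on $E$ is a map $x:\mathcal B(\mathbb R^2)\to E$ on the Borel $\sigma$-algebra such that $x(\mathbb R^2)=1$; $x(A\cup B)=x(A)+x(B)$ (the sum being defined in $E$) for disjoint Borel sets $A,B$; and $x(\bigcup_iA_i)=\bigvee_i x(A_i)$ for every non-decreasing sequence $(A_i)_i$ of Borel sets. *)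

(* Defs.v *)
From HB Require Import structures.
From mathcomp Require Import all_boot all_order all_algebra.
From mathcomp Require Import all_classical all_reals all_analysis.
Import Order.TTheory GRing.Theory Num.Theory.
Import numFieldNormedType.Exports.

Set Implicit Arguments.
Unset Strict Implicit.
Unset Printing Implicit Defensive.

Local Open Scope classical_set_scope.
Local Open Scope ring_scope.

(* A porderZmodType is an Abelian group and a partially ordered set, with no
   compatibility between the two structures; po_group adds it. *)
Definition po_group (G : porderZmodType) :=
  forall a b c : G, a <= b -> a + c <= b + c.

Definition directed (G : porderZmodType) :=
  forall a b : G, exists c : G, a <= c /\ b <= c.

Definition monotone_sigma_complete (G : porderZmodType) :=
  forall u : nat -> G, nondecreasing_seq u -> has_ubound (range u) ->
    exists g : G, supremums (range u) g.

Definition interpolation (G : porderZmodType) :=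
  forall a1 a2 b1 b2 : G,
    a1 <= b1 -> a1 <= b2 -> a2 <= b1 -> a2 <= b2 ->
    exists c : G, [/\ a1 <= c, a2 <= c, c <= b1 & c <= b2].

(* The lexicographic order comes from the library; the display ring_display and
   the componentwise group structure make this a porderZmodType. *)
Definition Zlex (G : porderZmodType) : Type := int *lexi[ring_display] G.

HB.instance Definition _ (G : porderZmodType) :=
  Order.POrder.copy (Zlex G) (int *lexi[ring_display] G).
HB.instance Definition _ (G : porderZmodType) :=
  GRing.Zmodule.copy (Zlex G) (int * G)%type.

Lemma le_ZlexE (G : porderZmodType) (m n : int) (g h : G) :
  ((m, g) : Zlex G) <= (n, h) = (m < n) || ((m == n) && (g <= h)).
Proof.
rewrite [LHS]Order.ProdLexiOrder.leEprodlexi /=.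
by case: (ltgtP m n) => //= ->; rewrite eqxx.
Qed.

Record Gamma_ea (H : porderZmodType) (u : H) : Type :=
  GammaEa { Gamma_val : H; _ : 0 <= Gamma_val <= u }.

HB.instance Definition _ (H : porderZmodType) (u : H) :=
  [isSub for @Gamma_val H u].
HB.instance Definition _ (H : porderZmodType) (u : H) :=
  [Choice of Gamma_ea u by <:].
HB.instance Definition _ (H : porderZmodType) (u : H) :=
  [SubChoice_isSubPOrder of Gamma_ea u by <: with ring_display].

(* The partial sum: None when the group sum leaves the interval (in a po-group,
   exactly when it is not below u). *)
Definition ea_add (H : porderZmodType) (u : H) (a b : Gamma_ea u) :
    option (Gamma_ea u) :=
  insub (\val a + \val b).

Section PerfectEffectAlgebra.
Context {G : porderZmodType}.

Definition Zlex_unit : Zlex G := (1, 0).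

Lemma Zlex_unit_ge0 : 0 <= Zlex_unit.
Proof. by rewrite le_ZlexE. Qed.

Definition ea0 : Gamma_ea Zlex_unit :=
  @GammaEa _ Zlex_unit 0 (introT andP (conj (lexx _) Zlex_unit_ge0)).
Definition ea1 : Gamma_ea Zlex_unit :=
  @GammaEa _ Zlex_unit Zlex_unit (introT andP (conj Zlex_unit_ge0 (lexx _))).

(* Rad(E)' : the complements 1 - a of the elements a of the radical. *)
Definition Rad_compl : set (Gamma_ea Zlex_unit) :=
  [set a | exists2 g : G, 0 <= g & \val a = (1, - g) :> Zlex G].

End PerfectEffectAlgebra.

Notation perfect_ea G := (Gamma_ea (@Zlex_unit G)).

Section SpectralResolution.
Context {R : realType} {G : porderZmodType}.
Implicit Type F : R * R -> perfect_ea G.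

Definition volume_condition F := forall a1 b1 a2 b2 : R,
  a1 <= b1 -> a2 <= b2 ->
  0 <= \val (F (b1, b2)) - \val (F (a1, b2)) - \val (F (b1, a2))
       + \val (F (a1, a2)).

(* For F satisfying the first four clauses of spectral_resolution2, both
   projections of the preimage are nonempty and bounded below, so that inf is
   a genuine infimum and its default value plays no role. *)
Definition characteristic_point F : R * R :=
  (inf [set p.1 | p in F @^-1` Rad_compl],
   inf [set p.2 | p in F @^-1` Rad_compl]).

Definition spectral_resolution2 F :=
  [/\ volume_condition F,
      forall t1 t2 : R,
        supremums [set F p | p in [set p | p.1 < t1 /\ p.2 < t2]] (F (t1, t2)),
      forall s : R,
        infimums (range (fun t => F (t, s))) ea0 /\
        infimums (range (fun t => F (s, t))) ea0,
      supremums (range F) ea1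
    & let: (s0, t0) := characteristic_point F in
      exists2 a : perfect_ea G,
        infimums [set F p | p in [set p | s0 < p.1 /\ t0 < p.2]] a
        & Rad_compl a].

End SpectralResolution.

Definition borel2 (R : realType) : set (set (R * R)) :=
  <<s [set A : set (R * R) | open A] >>.

(* As for the measures of the library, x is a total function whose values
   matter only on the sigma-algebra. *)
Definition observable2 (R : realType) (G : porderZmodType)
    (x : set (R * R) -> perfect_ea G) :=
  [/\ x setT = ea1,
      forall A B : set (R * R), borel2 A -> borel2 B -> A `&` B = set0 ->
        ea_add (x A) (x B) = Some (x (A `|` B))
    & forall A : nat -> set (R * R), (forall i, borel2 (A i)) ->
        nondecreasing_seq A ->
        supremums (range (fun i => x (A i))) (x (\bigcup_i A i))].

Definition extends2 (R : realType) (G : porderZmodType)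
    (x : set (R * R) -> perfect_ea G) (F : R * R -> perfect_ea G) :=
  forall s t : R, x (`]-oo, s[ `*` `]-oo, t[) = F (s, t).

(* Main.v *)
From HB Require Import structures.
Require Import Defs.
From mathcomp Require Import all_boot all_order all_algebra.
From mathcomp Require Import all_classical all_reals all_analysis.
From mathcomp Require Import measurable_realfun.
From mathcomp Require Import ring lra.
Import Order.TTheory GRing.Theory Num.Theory.
Import numFieldNormedType.Exports.

Set Implicit Arguments.
Unset Strict Implicit.
Unset Printing Implicit Defensive.

Local Open Scope classical_set_scope.
Local Open Scope ring_scope.

(* The integer part of F is the distribution function of the point mass at the
   characteristic point p0. Subtracting from F the value (1, gamma) that the
   observable must take at {p0} leaves a distribution function Phi with values
   in an interval [0, u] of G, and the problem is to extend Phi to a G-valued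
   measure. G need not be weakly sigma-distributive, so outer measures are of no
   use; instead one reduces to real measures by forcing. Conditions are the
   elements c of G with c <= u and not c <= 0, thought of as the region where c
   is positive. A descending chain w of conditions that meets countably many
   prescribed dense sets defines a real number h_w(x) for bounded x in G, in such
   a way that countably many given sums and countable suprema are preserved;
   and x <= 0 as soon as h_w(x) <= 0 for all sufficiently generic w. For generic
   w, h_w o Phi is thus a real distribution function, hence comes from a real
   measure mu_w. The Borel sets A for which some x in G satisfies
   h_w(x) = mu_w(A) generically form a lambda-system containing the quadrants,
   and x is the sought measure of A. Interpolation only serves to prove that G
   is archimedean. *)

(** * Abelian partially ordered groups *)

(** By [below_summand], a condition below a sum has a smaller condition below one of the summands.
    Applied to two elements with sum [u], this decides, up to an arbitrarily small error, on which
    side of a given rational x/u lies; so a generic chain acts like a point at which every x/u has a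
    value, additive in x. One chain can only meet countably many requirements. For this reason the
    distribution function is first used at rational points, and the chains that are generic for a
    Borel set A depend on A; the measures mu_w are fixed beforehand, and each closure step of the
    lambda-system combines countably many families of dense sets.

    The obstacle behind gamma is the lexicographic order: the volume condition says something about
    the G-part of a rectangle only when the integer part of its volume vanishes, that is, when the
    half-open rectangle misses p0. Around p0 the G-parts of the volumes decrease with the rectangle,
    and clause (v) bounds them from below, so they have an infimum gamma; once gamma is subtracted,
    every rectangle has nonnegative volume in G. *)

Module Abel.

Inductive exp :=
  | Var of nat | Zero | Add of exp & exp | Opp of exp | Muln of exp & nat.

Fixpoint eval (V : zmodType) (env : seq V) e : V :=
  match e with
  | Var i => nth 0 env i
  | Zero => 0
  | Add a b => eval env a + eval env b
  | Opp a => - eval env a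
  | Muln a n => eval env a *+ n
  end.

Fixpoint coef e (i : nat) : int :=
  match e with
  | Var j => (i == j)%:Z
  | Zero => 0
  | Add a b => coef a i + coef b i
  | Opp a => - coef a i
  | Muln a n => coef a i * n%:Z
  end.

Lemma evalE (V : zmodType) (env : seq V) e :
  eval env e = \sum_(i < size env) env`_i *~ coef e i.
Proof.
elim: e => [j||a IHa b IHb|a IHa|a IHa n] /=.
- have [lt_j|ge_j] := ltnP j (size env).
    rewrite (bigD1 (Ordinal lt_j)) //= eqxx mulr1z big1 ?addr0 // => i.
    by rewrite -val_eqE /= => /negbTE ->; rewrite mulr0z.
  rewrite nth_default // big1 // => i _.
  by rewrite ltn_eqF ?mulr0z // (leq_trans (ltn_ord i)).
- by rewrite big1 // => i _; rewrite mulr0z.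
- by rewrite IHa IHb -big_split /=; apply: eq_bigr => i _; rewrite mulrzDr.
- by rewrite IHa -sumrN; apply: eq_bigr => i _; rewrite mulrNz.
- by rewrite IHa -sumrMnl; apply: eq_bigr => i _; rewrite mulrzA pmulrn.
Qed.

Definition check n e1 e2 := all (fun i => coef e1 i == coef e2 i) (iota 0 n).

Lemma checkP (V : zmodType) (env : seq V) e1 e2 :
  check (size env) e1 e2 -> eval env e1 = eval env e2.
Proof.
move=> /allP e12; rewrite !evalE; apply: eq_bigr => i _; congr (_ *~ _).
by apply/eqP/e12; rewrite mem_iota add0n ltn_ord.
Qed.

(* Atoms are compared by unification: instances may differ syntactically. *)
Ltac mem x l :=
  match l with
  | nil => constr:(false)
  | cons ?y _ => let _ := match goal with _ => unify x y end in constr:(true)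
  | cons _ ?l' => mem x l'
  end.

Ltac index x l :=
  match l with
  | cons ?y _ => let _ := match goal with _ => unify x y end in constr:(0%N)
  | cons _ ?l' => let n := index x l' in constr:(S n)
  end.

(** Only a literal multiplicity gives a coefficient that computes; [x *+ n] with [n] not a literal
    is treated as an atom. *)
Ltac isnat n :=
  match n with O => idtac | S ?m => isnat m end.

Ltac atoms t l :=
  lazymatch t with
  | @GRing.add _ ?a ?b => let l' := atoms a l in atoms b l'
  | @GRing.opp _ ?a => atoms a l
  | @GRing.zero _ => l
  | @GRing.natmul _ ?a ?n =>
      match t with
      | _ => let _ := match goal with _ => isnat n end in atoms a l
      | _ => let b := mem t l in
          match b with true => l | false => constr:(cons t l) end
      end
  | _ => let b := mem t l in
      match b with true => l | false => constr:(cons t l) end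
  end.

Ltac reify t l :=
  lazymatch t with
  | @GRing.add _ ?a ?b =>
      let a' := reify a l in let b' := reify b l in constr:(Add a' b')
  | @GRing.opp _ ?a => let a' := reify a l in constr:(Opp a')
  | @GRing.zero _ => constr:(Zero)
  | @GRing.natmul _ ?a ?n =>
      match t with
      | _ => let _ := match goal with _ => isnat n end in
             let a' := reify a l in constr:(Muln a' n)
      | _ => let i := index t l in constr:(Var i)
      end
  | _ => let i := index t l in constr:(Var i)
  end.

End Abel.

(* Decides equations of Abelian groups, [ring] being restricted to rings. *)
Ltac abel :=
  lazymatch goal with
  | |- @eq ?T ?a ?b =>
    let l0 := constr:(@nil T) in
    let l1 := Abel.atoms a l0 in
    let l := Abel.atoms b l1 in
    let e1 := Abel.reify a l in
    let e2 := Abel.reify b l in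
    lazymatch l with
    | cons ?x _ => let U := type of x in
                   exact (@Abel.checkP _ (l : list U) e1 e2 isT)
    end
  end.

Section PoGroup.
Context (G : porderZmodType) (Gpo : po_group G).
Implicit Types (x y a b c e : G) (n m k : nat).

(** The standard way to prove inequalities below: sum up the known ones, and leave the comparison of
    the differences to [abel]. *)
Lemma le_sub_eq x y a b : x <= y -> b - a = y - x -> a <= b.
Proof.
move=> le_xy E; have := Gpo (a - x) le_xy.
have -> : x + (a - x) = a by abel.
have -> : y + (a - x) = b - a + a by rewrite E; abel.
by rewrite subrK.
Qed.

Lemma poD x y a b : x <= y -> a <= b -> x + a <= y + b.
Proof.
move=> le_xy le_ab; apply: le_trans (Gpo a le_xy) _.
by rewrite ![y + _]addrC; apply: Gpo.
Qed.

Lemma poMn n x y : x <= y -> x *+ n <= y *+ n.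
Proof.
by move=> le_xy; elim: n => [|n IH]; rewrite ?mulr0n ?mulrS //; exact: poD.
Qed.

Lemma po_mulrn_ge0 x n : 0 <= x -> 0 <= x *+ n.
Proof. by move=> /(poMn n); rewrite mul0rn. Qed.

Context (Gdir : directed G).

Lemma upper_bound_mulrn x n : exists2 e, 0 <= e & forall k, (k < n)%N -> x *+ k <= e.
Proof.
elim: n => [|n [e e0 He]]; first by exists 0.
have [b [eb nb]] := Gdir e (x *+ n).
exists b => [|k]; first exact: le_trans eb.
by rewrite ltnS leq_eqVlt => /predU1P[->//|/He]; move/le_trans; exact.
Qed.

Context (Gsigma : monotone_sigma_complete G) (Gint : interpolation G).

(** Interpolating against one [b n] at a time gives a decreasing sequence above [a1] and [a2]; its
    infimum, obtained as the opposite of a supremum, is still above both. *)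
Lemma countable_interpolation (a1 a2 : G) (b : nat -> G) :
  (forall n, a1 <= b n) -> (forall n, a2 <= b n) ->
  exists c, [/\ a1 <= c, a2 <= c & forall n, c <= b n].
Proof.
move=> a1b a2b.
pose S := {c : G | a1 <= c /\ a2 <= c}.
have step (s : S) n : {t : S | sval t <= sval s /\ sval t <= b n}.
  apply: cid; case: s => s [a1s a2s].
  have [c [a1c a2c cs cb]] := Gint a1s (a1b n) a2s (a2b n).
  by exists (exist _ c (conj a1c a2c)).
pose fix w n : S :=
  if n is m.+1 then sval (step (w m) m) else exist _ (b 0%N) (conj (a1b _) (a2b _)).
have wS n : sval (w n.+1) <= sval (w n) /\ sval (w n.+1) <= b n.
  exact: (svalP (step (w n) n)).
have wN : nondecreasing_seq (fun n => - sval (w n)).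
  apply/nondecreasing_seqP => n.
  by apply: le_sub_eq (wS n).1 _; abel.
have [] := Gsigma wN.
  exists (- a1) => _ [n _ <-].
  by apply: le_sub_eq (svalP (w n)).1 _; abel.
move=> g [gub glub]; exists (- g); split.
- have : g <= - a1.
    by apply: glub => _ [n _ <-]; apply: le_sub_eq (svalP (w n)).1 _; abel.
  by move/le_sub_eq; apply; abel.
- have : g <= - a2.
    by apply: glub => _ [n _ <-]; apply: le_sub_eq (svalP (w n)).2 _; abel.
  by move/le_sub_eq; apply; abel.
- move=> n; apply: le_trans (wS n).2.
  have : - sval (w n.+1) <= g by apply: gub; exists n.+1.
  by move/le_sub_eq; apply; abel.
Qed.

(* If all multiples of x are below y, interpolation yields w_0 <= w_1 <= ...
   below y with w_n + x <= w_(n+1); their supremum w satisfies w + x <= w. *)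
Lemma archimedean x y : (forall n, x *+ n <= y) -> x <= 0.
Proof.
move=> xy; pose S := {w : G | forall n, w + x *+ n <= y}.
have step (s : S) : {t : S | sval s <= sval t /\ sval s + x <= sval t}.
  apply: cid; case: s => s Hs.
  have [|n|c [sc sxc cb]] :=
      @countable_interpolation s (s + x) (fun n => y - x *+ n).
  - by move=> n; apply: le_sub_eq (Hs n) _; abel.
  - by apply: le_sub_eq (Hs n.+1) _; rewrite mulrS; abel.
  - have Hc n : c + x *+ n <= y by apply: le_sub_eq (cb n) _; abel.
    by exists (exist _ c Hc).
have H0 n : 0 + x *+ n <= y by rewrite add0r.
pose fix w n : S := if n is m.+1 then sval (step (w m)) else exist _ 0 H0.
have wS n : sval (w n) <= sval (w n.+1) /\ sval (w n) + x <= sval (w n.+1).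
  exact: (svalP (step (w n))).
have [] := @Gsigma (fun n => sval (w n)).
- by apply/nondecreasing_seqP => n; exact: (wS n).1.
- by exists y => _ [n _ <-]; have := svalP (w n) 0%N; rewrite mulr0n addr0.
move=> g [gub glub]; have : g <= g - x.
  apply: glub => _ [n _ <-].
  have : sval (w n.+1) <= g by apply: gub; exists n.+1.
  by move/(le_trans (wS n).2)/le_sub_eq; apply; abel.
by move/le_sub_eq; apply; abel.
Qed.

(** Division of k by n bounds every multiple of x by one of the finitely many remainders [x *+ r], r
    < n. These have a common bound because G is directed, and the archimedean property applies. *)
Lemma unperforated x n : (0 < n)%N -> x *+ n <= 0 -> x <= 0.
Proof.
move=> n0 xn; have [e _ He] := upper_bound_mulrn x n.
apply: (@archimedean x e) => k; rewrite (divn_eq k n) mulrnDr.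
have := poD (poMn (k %/ n) xn) (He _ (ltn_pmod k n0)).
by rewrite mul0rn add0r -mulrnA mulnC.
Qed.

(* In a lattice-ordered group, if c /\ a <= 0 and c /\ b <= 0 then c <= 0; here,
   every upper bound e of 0 and a is such that e - c is one too, so that all
   multiples of c are below any of them. *)
Lemma below_summand a b c : c <= a + b -> ~ c <= 0 ->
  exists c', [/\ ~ c' <= 0, c' <= c & c' <= a \/ c' <= b].
Proof.
move=> cab; apply: contra_notP => /forallNP H.
have Ha z : z <= c -> z <= a -> z <= 0.
  by move=> zc za; apply: contrapT => z0; apply: (H z); split => //; left.
have Hb z : z <= c -> z <= b -> z <= 0.
  by move=> zc zb; apply: contrapT => z0; apply: (H z); split => //; right.
have down e : 0 <= e -> a <= e -> 0 <= e - c /\ a <= e - c.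
  move=> e0 ae.
  have ce : c <= e.
    have : c - e <= 0.
      apply: Hb; first by apply: le_sub_eq e0 _; abel.
      by apply: le_sub_eq (poD cab ae) _; abel.
    by move/le_sub_eq; apply; abel.
  split; first by apply: le_sub_eq ce _; abel.
  have : c - (e - a) <= 0.
    by apply: Ha; [apply: le_sub_eq ae _|apply: le_sub_eq ce _]; abel.
  by move/le_sub_eq; apply; abel.
have [e [ae e0]] := Gdir a 0.
apply: (@archimedean c e) => n.
suff : 0 <= e - c *+ n /\ a <= e - c *+ n.
  by case=> /le_sub_eq + _; apply; abel.
elim: n => [|n [IH1 IH2]]; first by rewrite mulr0n subr0.
have [] := down _ IH1 IH2.
by have -> : e - c *+ n.+1 = e - c *+ n - c by rewrite mulrSr; abel.
Qed.

(** Copies of [u] are split off one by one with [below_summand]. This turns a bounded element that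
    is not below 0 into a condition. *)
Lemma below_unit u d N : 0 <= u -> ~ d <= 0 -> d <= u *+ N ->
  exists c, [/\ ~ c <= 0, c <= d & c <= u].
Proof.
move=> u0; elim: N d => [|N IH] d d0; first by rewrite mulr0n => /d0.
rewrite mulrS => /below_summand/(_ d0)[c [c0 cd [cu|cN]]]; first by exists c.
have [c' [c'0 c'c c'u]] := IH c c0 cN.
by exists c'; split => //; exact: le_trans cd.
Qed.

(** As both sequences decrease, z lies below [x n + y m] for independent n and m; the infimum is
    taken over n first, then over m. *)
Lemma inf0D (x y : nat -> G) :
  nonincreasing_seq x -> nonincreasing_seq y ->
  (forall z, (forall n, z <= x n) -> z <= 0) ->
  (forall z, (forall n, z <= y n) -> z <= 0) ->
  forall z, (forall n, z <= x n + y n) -> z <= 0.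
Proof.
move=> xd yd x0 y0 z zxy; apply: y0 => m.
have : z - y m <= 0.
  apply: x0 => n; pose k := maxn n m.
  apply: le_sub_eq (poD (zxy k) (poD (xd n k (leq_maxl _ _)) (yd m k (leq_maxr _ _)))) _.
  by abel.
by move/le_sub_eq; apply; abel.
Qed.

Lemma inf0Mn (x : nat -> G) k :
  nonincreasing_seq x -> (forall z, (forall n, z <= x n) -> z <= 0) ->
  forall z, (forall n, z <= x n *+ k) -> z <= 0.
Proof.
move=> xd x0; elim: k => [z /(_ 0%N)//|k IH z zx].
apply: (@inf0D x (fun n => x n *+ k)) => // [m n mn|n].
  by apply: poMn; exact: xd.
by rewrite -mulrS.
Qed.

End PoGroup.

(** * Chains of conditions and the real values they define *)

Definition po_bounded (G : porderZmodType) (u x : G) :=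
  exists M : nat, - (u *+ M) <= x /\ x <= u *+ M.

Section Conditions.
Context (G : porderZmodType) (u : G).
Implicit Types (c : G) (w : nat -> G) (D : set G).

(* A condition c stands for the region where c is positive. *)
Definition condition c := ~ c <= 0 /\ c <= u.

Definition chain w := forall n, condition (w n) /\ w n.+1 <= w n.

Definition dense_below D :=
  forall c, condition c -> exists c', [/\ condition c', c' <= c & D c'].

(** The sets [D k] need not be downward closed, so their intersections may fail to be dense. A
    countable family, each member of which is met somewhere, is what makes the notion stable under
    countable conjunctions. *)
Definition generically (Phi : set (nat -> G)) :=
  exists2 D : nat -> set G, (forall k, dense_below (D k)) &
    forall w, chain w -> (forall k, exists n, D k (w n)) -> Phi w.

(** Some condition of the chain forces x to be positive; the factor j makes this stable under
    sums. *)
Definition eventually_pos w (x : G) :=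
  exists n j, (0 < j)%N /\ w n *+ j <= x.

(** The Dedekind cut of x/u at the point described by the chain: a/b is a lower estimate when
    [x *+ b - u *~ a] is forced to be positive. *)
Definition chain_value (R : realType) w (x : G) : R :=
  sup [set r | exists a : int, exists b : nat,
    [/\ (0 < b)%N, r = a%:~R / b%:R & eventually_pos w (x *+ b - u *~ a)]].

Lemma generically_dense D : dense_below D ->
  generically (fun w => exists n, D (w n)).
Proof. by move=> dD; exists (fun=> D) => // w _ /(_ 0%N). Qed.

Lemma generically_all (I : countType) (Phi : I -> set (nat -> G)) :
  (forall i, generically (Phi i)) -> generically (fun w => forall i, Phi i w).
Proof.
move=> /(_ _)/cid2-/all_sig2[D dD DP].
exists (fun k => if unpickle k is Some (i, l) then D i l else setT).
  move=> k; case: unpickle => [[i l]|]; first exact: dD.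
  by move=> c Pc; exists c.
move=> w cw H i; apply: DP => // l.
by have := H (pickle (i, l)); rewrite pickleK.
Qed.

Lemma generically_impl (Phi Psi : set (nat -> G)) : generically Phi ->
  (forall w, chain w -> Phi w -> Psi w) -> generically Psi.
Proof. by move=> [D dD DP] H; exists D => // w cw Dw; apply: H => //; exact: DP. Qed.

Lemma generically_and (Phi Psi : set (nat -> G)) : generically Phi ->
  generically Psi -> generically (fun w => Phi w /\ Psi w).
Proof.
move=> HP HQ.
have := @generically_all bool (fun b => if b then Phi else Psi).
move=> /(_ _)/generically_impl; apply; first by case.
by move=> w _ H; split; [exact: (H true)|exact: (H false)].
Qed.

(* The Baire category argument. *)
Lemma generically_exists (Phi : set (nat -> G)) c : generically Phi ->
  condition c -> exists w, [/\ chain w, w 0%N = c & Phi w].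
Proof.
move=> [D dD DP] Pc; pose C := {c | condition c}.
have step (s : C) k : {t : C | sval t <= sval s /\ D k (sval t)}.
  apply: cid; case: s => s Ps; have [t [Pt ts Dt]] := dD k s Ps.
  by exists (exist _ t Pt).
pose fix w n : C := if n is m.+1 then sval (step (w m) m) else exist _ c Pc.
have wS n := svalP (step (w n) n).
have cw : chain (fun n => sval (w n)).
  by move=> n; split; [exact: (svalP (w n))|exact: (wS n).1].
exists (fun n => sval (w n)); split => //.
by apply: DP => // k; exists k.+1; exact: (wS k).2.
Qed.

End Conditions.

(** * Real values along a generic chain *)

Section ChainValue.
Context (R : realType) (G : porderZmodType) (Gpo : po_group G)
  (Gdir : directed G) (Gsigma : monotone_sigma_complete G)
  (Gint : interpolation G) (u : G) (u0 : 0 <= u).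
Implicit Types (x y z : G) (w : nat -> G).
Local Notation pos := eventually_pos.
Local Notation h := (chain_value u R).
Local Notation bounded := (po_bounded u).

Lemma po_boundedN x : bounded x -> bounded (- x).
Proof.
move=> [M [lo hi]]; exists M; split.
  by apply: (le_sub_eq Gpo hi); abel.
by apply: (le_sub_eq Gpo lo); abel.
Qed.

Lemma po_boundedD x y : bounded x -> bounded y -> bounded (x + y).
Proof.
move=> [M [lo hi]] [N [lo' hi']]; exists (M + N)%N; rewrite mulrnDr; split.
  by apply: (le_sub_eq Gpo (poD Gpo lo lo')); abel.
exact: poD.
Qed.

Lemma po_bounded_itv x : 0 <= x <= u -> bounded x.
Proof.
move=> /andP[x0 xu]; exists 1%N; rewrite mulr1n; split => //.
by apply: (le_sub_eq Gpo (poD Gpo x0 u0)); abel.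
Qed.

Lemma po_boundedB x y : bounded x -> bounded y -> bounded (x - y).
Proof. by move=> bx by_; apply: po_boundedD => //; exact: po_boundedN. Qed.

Lemma chain_le w n m : chain u w -> (n <= m)%N -> w m <= w n.
Proof.
move=> cw; elim: m => [|m IH]; first by rewrite leqn0 => /eqP->.
rewrite leq_eqVlt => /predU1P[->//|]; rewrite ltnS => /IH.
exact: le_trans (cw m).2.
Qed.

Lemma pos_le w x y : pos w x -> x <= y -> pos w y.
Proof. by move=> [n [j [j0 H]]] xy; exists n, j; split => //; exact: le_trans xy. Qed.

Lemma posD w x y : chain u w -> pos w x -> pos w y -> pos w (x + y).
Proof.
move=> cw [n [j [j0 nx]]] [m [k [k0 my]]]; exists (maxn n m), (j + k)%N.
split; first by rewrite addn_gt0 j0.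
rewrite mulrnDr; apply: (poD Gpo).
  by apply: le_trans nx; apply: (poMn Gpo); apply: chain_le; rewrite ?leq_maxl.
by apply: le_trans my; apply: (poMn Gpo); apply: chain_le; rewrite ?leq_maxr.
Qed.

Lemma posMn w x k : pos w x -> (0 < k)%N -> pos w (x *+ k).
Proof.
move=> [n [j [j0 nx]]] k0; exists n, (j * k)%N; split; first by rewrite muln_gt0 j0.
by rewrite mulrnA; exact: (poMn Gpo).
Qed.

Lemma pos_neq0 w : chain u w -> ~ pos w 0.
Proof.
move=> cw [n [j [j0]]] /(unperforated Gpo Gdir Gsigma Gint j0).
exact: (cw n).1.1.
Qed.

Lemma pos_unit w (a : int) : chain u w -> pos w (u *~ a) <-> 0 < a.
Proof.
move=> cw; split=> [pa|]; last first.
  case: a => // -[//|n] _; apply: posMn => //.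
  by exists 0%N, 1%N; split => //; rewrite mulr1n; exact: (cw 0%N).1.2.
rewrite ltNge; apply/negP => a0; apply: (pos_neq0 cw); apply: pos_le pa _.
rewrite -[a]opprK mulrNz; have : 0 <= - a by rewrite oppr_ge0.
case: (- a) => // n _; have := po_mulrn_ge0 Gpo n u0.
by move/(le_sub_eq Gpo); apply; rewrite pmulrn; abel.
Qed.

Lemma chain_value_le w x (r : R) : chain u w -> bounded x ->
  (forall (a : int) (b : nat), (0 < b)%N -> pos w (x *+ b - u *~ a) ->
     a%:~R / b%:R <= r) -> h w x <= r.
Proof.
move=> cw [M [lo _]] H; apply: ge_sup => [|_ [a [b [b0 -> p]]]]; last exact: H.
(* The set of lower estimates is nonempty: from -M u <= x follows u <= x + (M+1) u, and u is forced
   to be positive. *)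
exists ((- M.+1%:Z)%:~R / 1%:R), (- M.+1%:Z), 1%N; split => //.
have : pos w (u *~ 1) by apply/pos_unit.
move/pos_le; apply; apply: (le_sub_eq Gpo lo).
by rewrite mulr1z mulr1n mulrNz -pmulrn mulrS; abel.
Qed.

Lemma chain_value_ge w x (a : int) (b : nat) : chain u w -> bounded x ->
  (0 < b)%N -> pos w (x *+ b - u *~ a) -> a%:~R / b%:R <= h w x.
Proof.
move=> cw [M [_ hi]] b0 p; apply: ub_le_sup; last by exists a, b.
exists M%:R => _ [a' [b' [b'0 -> p']]].
have : pos w (u *~ ((M * b')%N%:Z - a')).
  apply: (pos_le p'); apply: (le_sub_eq Gpo (poMn Gpo b' hi)).
  by rewrite mulrzBr -pmulrn mulrnA; abel.
move/(pos_unit _ cw); rewrite subr_gt0 => aM.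
rewrite ler_pdivrMr ?ltr0n //; apply: ltW.
by rewrite -natrM pmulrn ltr_int.
Qed.

(** Lower estimates of x and y add up along every chain. The converse inequality would split an
    estimate of the sum, and is obtained for generic chains. *)
Lemma chain_value_superadd w x y : chain u w -> bounded x -> bounded y ->
  h w x + h w y <= h w (x + y).
Proof.
move=> cw bx by_; have bxy := po_boundedD bx by_.
rewrite -lerBrDr; apply: chain_value_le => // a b b0 p.
rewrite lerBrDr -lerBrDl; apply: chain_value_le => // a' b' b'0 p'.
rewrite lerBrDl.
have -> : (a%:~R / b%:R + a'%:~R / b'%:R : R) =
    (a * b'%:Z + a' * b%:Z)%:~R / (b * b')%N%:R.
  rewrite rmorphD !rmorphM /= -!pmulrn.
  by field; rewrite !pnatr_eq0 -!lt0n b0 b'0.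
apply: chain_value_ge => //; first by rewrite muln_gt0 b0.
apply: pos_le (posD cw (posMn p b'0) (posMn p' b0)) _.
rewrite le_eqVlt; apply/orP; left; apply/eqP.
rewrite mulrzDr [(x + y) *+ _]mulrnDl (mulrnA x) (mulnC b b') (mulrnA y) !mulrzA -!pmulrn.
by rewrite !mulrnBl; abel.
Qed.

Lemma le_of_invn (x y : R) : (forall b : nat, (0 < b)%N -> x - b%:R^-1 <= y) -> x <= y.
Proof.
move=> H; apply/ler_addgt0Pl => e e0.
have [b be] := ltr_add_invr e0.
move: (H b.+1 isT); rewrite add0r in be; rewrite lerBlDr => /le_trans; apply.
by rewrite addrC lerD2r ltW.
Qed.

(** As positivity is strict ([pos_neq0]), 0 itself may fail to be a lower estimate; -1/b is one for
    every b > 0. *)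
Lemma chain_value_ge0 w x : chain u w -> bounded x -> 0 <= x -> 0 <= h w x.
Proof.
move=> cw bx x0; apply: le_of_invn => b b0; rewrite sub0r.
have := @chain_value_ge w x (-1) b cw bx b0; rewrite rmorphN1 mulN1r; apply.
have : pos w (u *~ 1) by apply/pos_unit.
move/pos_le; apply; apply: (le_sub_eq Gpo (po_mulrn_ge0 Gpo b x0)).
by rewrite mulrNz; abel.
Qed.

Lemma chain_value0 w : chain u w -> h w 0 = 0.
Proof.
move=> cw; have b0 : bounded 0 by exists 0%N; rewrite mulr0n oppr0.
apply/eqP; rewrite eq_le chain_value_ge0 // andbT.
apply: chain_value_le => // a b b_gt0; rewrite mul0rn add0r -mulrNz.
move=> /(pos_unit _ cw); rewrite oppr_gt0 => a0.
by rewrite pmulr_lle0 ?invr_gt0 ?ltr0n // lerz0 ltW.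
Qed.

Lemma chain_value_unit w : chain u w -> h w u = 1.
Proof.
move=> cw; have bu : bounded u by apply: po_bounded_itv; rewrite lexx u0.
apply/eqP; rewrite eq_le; apply/andP; split.
  apply: chain_value_le => // a b b0; rewrite pmulrn -mulrzBr.
  move=> /(pos_unit _ cw); rewrite subr_gt0 => ab.
  by rewrite ler_pdivrMr ?ltr0n // mul1r pmulrn ler_int ltW.
apply: le_of_invn => b b0.
have -> : 1 - b%:R^-1 = (b%:Z - 1)%:~R / b%:R :> R.
  by rewrite rmorphB /= mulrBl divff ?mul1r // pnatr_eq0 -lt0n.
apply: chain_value_ge => //; rewrite pmulrn -mulrzBr opprB addrCA subrr addr0.
by apply/pos_unit.
Qed.

(** The elements b x - a u and -b x + (a+1) u have sum u, so that each condition can be refined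
    below one of them: a/b is a lower estimate of x, or -(a+1)/b is one of -x. *)
Lemma generically_valueN x : bounded x ->
  generically u (fun w => - h w x <= h w (- x)).
Proof.
move=> bx.
pose D (ab : int * nat) := [set c : G | c <= x *+ ab.2 - u *~ ab.1 \/
  c <= (- x) *+ ab.2 - u *~ (- (ab.1 + 1))].
have dD ab : dense_below u (D ab).
  move=> c [c0 cu].
  have cab : c <= (x *+ ab.2 - u *~ ab.1) +
      ((- x) *+ ab.2 - u *~ (- (ab.1 + 1))).
    apply: (le_sub_eq Gpo cu); rewrite mulrNz mulrzDr mulNrn mulr1z; abel.
  have [c' [c'0 c'c Dc']] := below_summand Gpo Gdir Gsigma Gint cab c0.
  by exists c'; split => //; split => //; exact: le_trans cu.
have := generically_all (fun ab => generically_dense (dD ab)).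
move=> /generically_impl; apply => w cw Dw.
have bNx := po_boundedN bx.
apply: le_of_invn => b b0.
suff H k : (0 < k)%N -> - h w x - 2 / k%:R <= h w (- x).
  have := H (b * 2)%N; rewrite muln_gt0 b0 => /(_ isT).
  by rewrite natrM invfM mulrCA divff ?mulr1 ?pnatr_eq0.
(* a/k is the first multiple of 1/k strictly above the value of x, which rules out the first
   alternative of [D (a, k)]; the second one loses at most 2/k. *)
move=> k0; pose a := Num.floor (h w x * k%:R) + 1.
have k0R : (0 : R) < k%:R by rewrite ltr0n.
have ha : h w x < a%:~R / k%:R by rewrite ltr_pdivlMr // Num.Theory.floorD1_gt.
have ha1 : a%:~R / k%:R <= h w x + k%:R^-1.
  rewrite ler_pdivrMr // mulrDl mulVf ?gt_eqF // /a rmorphD /= lerD2r.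
  exact: Num.Theory.floor_le.
have [n [pn|pn]] := Dw (a, k).
  have : a%:~R / k%:R <= h w x.
    by apply: chain_value_ge => //; exists n, 1%N; rewrite mulr1n.
  by rewrite leNgt ha.
have : (- (a + 1))%:~R / k%:R <= h w (- x).
  by apply: chain_value_ge => //; exists n, 1%N; rewrite mulr1n.
apply: le_trans; rewrite rmorphN rmorphD /= mulNr mulrDl mul1r opprD.
lra.
Qed.

(** Superadditivity for x + y and -y, whose sum is x, supplies the missing upper bound. *)
Lemma generically_valueD x y : bounded x -> bounded y ->
  generically u (fun w => h w (x + y) = h w x + h w y).
Proof.
move=> bx by_; apply: generically_impl (generically_valueN by_) _ => w cw Hy.
apply/eqP; rewrite eq_le chain_value_superadd // andbT.
have := chain_value_superadd cw (po_boundedD bx by_) (po_boundedN by_).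
rewrite addrK; lra.
Qed.

Lemma generically_valueB x y : bounded x -> bounded y ->
  generically u (fun w => h w (x - y) = h w x - h w y).
Proof.
move=> bx by_; apply: generically_impl (generically_valueD (po_boundedB bx by_) by_) _.
by move=> w cw; rewrite subrK => ->; rewrite addrK.
Qed.

(* Here genericity is confronted with order: if x is not below 0, some condition
   lies below a multiple of x minus u, and forces the value of x to be positive. *)
Lemma generically_value_le0 x : bounded x ->
  generically u (fun w => h w x <= 0) -> x <= 0.
Proof.
move=> bx gen; apply: contrapT => x0.
have [k Hk] : exists k, ~ x *+ k <= u.
  apply/existsNP => H; apply: x0.
  exact: (archimedean Gpo Gsigma Gint H).
have [M [_ hi]] := bx.
have [||c [c0 cd cu]] := below_unit Gpo Gdir Gsigma Gint u0
    (d := x *+ k - u) (N := (M * k)%N).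
- by move=> H; apply: Hk; apply: (le_sub_eq Gpo H); abel.
- by rewrite mulrnA; apply: (le_sub_eq Gpo (poD Gpo (poMn Gpo k hi) u0)); abel.
have [w [cw w0 hx]] := generically_exists gen (conj c0 cu).
have k0 : (0 < k)%N.
  by rewrite lt0n; apply: contra_notN Hk => /eqP->; rewrite mulr0n.
have : (1 : int)%:~R / k%:R <= h w x.
  apply: chain_value_ge => //; exists 0%N, 1%N; split => //.
  by rewrite mulr1n w0 mulr1z.
by move=> /le_trans/(_ hx); rewrite mulr1z mul1r leNgt invr_gt0 ltr0n k0.
Qed.

(** A condition c cannot lie below all [x n *+ k], whose infimum is 0. So some c - k x_n is a
    condition; it lies below u - k x_n, and hence forces the value of x_n to be at most 1/k. *)
Lemma generically_value_inf0 (x : nat -> G) :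
  (forall n, bounded (x n)) -> nonincreasing_seq x ->
  (forall n, 0 <= x n) -> (forall z, (forall n, z <= x n) -> z <= 0) ->
  generically u (fun w => forall e : R, 0 < e -> exists n, h w (x n) <= e).
Proof.
move=> bx xd x0 xinf.
pose D k := [set c : G | exists n, c <= u - x n *+ k].
have dD k : dense_below u (D k).
  move=> c [c0 cu]; apply: contrapT => /forallNP H; apply: c0.
  apply: (inf0Mn Gpo (k := k) xd xinf) => n.
  have : c - x n *+ k <= 0.
    apply: contrapT => z0; apply: (H (c - x n *+ k)).
    have zc : c - x n *+ k <= c.
      by apply: (le_sub_eq Gpo (po_mulrn_ge0 Gpo k (x0 n))); abel.
    split => //; first by split => //; exact: le_trans cu.
    by exists n; apply: (le_sub_eq Gpo cu); abel.
  by move/(le_sub_eq Gpo); apply; abel.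
have := generically_all (fun k => generically_dense (dD k)).
move=> /generically_impl; apply => w cw Dw e e0.
have [k ke] := ltr_add_invr e0; rewrite add0r in ke.
have [m [n mn]] := Dw k.+1; exists n.
have : (-1 : int)%:~R / k.+1%:R <= h w (- x n).
  apply: chain_value_ge => //; first exact: po_boundedN.
  exists m, 1%N; split => //.
  by rewrite mulr1n mulrNz mulr1z mulNrn; apply: (le_sub_eq Gpo mn); abel.
have := chain_value_superadd cw (bx n) (po_boundedN (bx n)).
rewrite subrr chain_value0 // rmorphN1 mulN1r => hle hge.
have aux (p q r s : R) : p + q <= 0 -> - r <= q -> r <= s -> p <= s by lra.
exact: aux hle hge (ltW ke).
Qed.

End ChainValue.

(** * Real distribution functions in the plane *)

Section DistributionExtension.
Context (R : realType) (f : rat -> rat -> R).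
Context (f_ge0 : forall q r, 0 <= f q r) (f_le1 : forall q r, f q r <= 1).
Context (f_mono : forall q q' r r' : rat, q <= q' -> r <= r' -> f q r <= f q' r').
Context (f_volume : forall q q' r r' : rat, q <= q' -> r <= r' ->
  0 <= f q' r' - f q r' - f q' r + f q r).
Implicit Types x y : \bar R.

(* The value 0 keeps the supremum meaningful when x or y is -oo. *)
Definition below_values x y : set R := [set v | v = 0 \/
  exists q r : rat, [/\ ((ratr q)%:E < x)%E, ((ratr r)%:E < y)%E & v = f q r]].

Definition extension x y : R := sup (below_values x y).

Lemma has_sup_below_values x y : has_sup (below_values x y).
Proof.
split; first by exists 0; left.
by exists 1 => _ [->|[q [r [_ _ ->]]]].
Qed.

Lemma extension_ub x y v : below_values x y v -> v <= extension x y.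
Proof. by apply: ub_le_sup; exact: (has_sup_below_values x y).2. Qed.

Lemma extension_le x y v : 0 <= v ->
  (forall q r : rat, ((ratr q)%:E < x)%E -> ((ratr r)%:E < y)%E -> f q r <= v) ->
  extension x y <= v.
Proof.
move=> v0 H; apply: ge_sup; first by exists 0; left.
by move=> _ [->//|[q [r [qx ry ->]]]]; exact: H.
Qed.

Lemma extension_mono x x' y y' : (x <= x')%E -> (y <= y')%E ->
  extension x y <= extension x' y'.
Proof.
move=> xx' yy'; apply: extension_le => [|q r qx ry].
  by apply: extension_ub; left.
apply: extension_ub; right; exists q, r.
by split => //; [exact: lt_le_trans xx'|exact: lt_le_trans yy'].
Qed.

Lemma extension_Ny y : extension -oo%E y = 0.
Proof.
apply/eqP; rewrite eq_le; apply/andP; split; last by apply: extension_ub; left.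
by apply: extension_le => // q r; rewrite ltNge leNye.
Qed.

Lemma extension_xN x : extension x -oo%E = 0.
Proof.
apply/eqP; rewrite eq_le; apply/andP; split; last by apply: extension_ub; left.
by apply: extension_le => // q r _; rewrite ltNge leNye.
Qed.

Lemma extension_volume x x' y y' : (x <= x')%E -> (y <= y')%E ->
  0 <= extension x' y' - extension x y' - extension x' y + extension x y.
Proof.
move=> xx' yy'.
suff H : extension x y' + extension x' y <= extension x' y' + extension x y.
  move: H; lra.
have p0 : 0 <= extension x y by apply: extension_ub; left.
rewrite -lerBrDr; apply: extension_le => [|q r qx ry].
  rewrite subr_ge0 (le_trans (extension_mono (lexx x') yy')) //.
  by rewrite lerDl.
rewrite lerBrDr -lerBrDl; apply: extension_le => [|q' r' qx' ry'].
  rewrite subr_ge0; have : f q r <= extension x' y'.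
    apply: extension_ub; right; exists q, r; split => //.
    exact: lt_le_trans xx'.
  by move/le_trans; apply; rewrite lerDl.
rewrite lerBrDl.
(* The volume of f is used on [q, q2] x [r', r2]: q2 and r2 are still below x' and y', while q and
   r' are below x and y. *)
pose q2 := Order.max q q'; pose r2 := Order.max r r'.
have H1 : f q2 r2 <= extension x' y'.
  apply: extension_ub; right; exists q2, r2.
  rewrite /q2 /r2 !maxEle; split => //; case: ifP => // _.
    exact: lt_le_trans xx'.
  exact: lt_le_trans yy'.
have H2 : f q r' <= extension x y by apply: extension_ub; right; exists q, r'.
have qq2 : q <= q2 by rewrite le_max lexx.
have rr2 : r' <= r2 by rewrite le_max lexx orbT.
have H3 := f_volume qq2 rr2.
have H4 : f q r <= f q r2 by apply: f_mono => //; rewrite le_max lexx.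
have H5 : f q' r' <= f q2 r' by apply: f_mono => //; rewrite le_max lexx orbT.
lra.
Qed.

Lemma extension_rat q r :
  (forall e : R, 0 < e -> exists q' r' : rat, [/\ q' < q, r' < r & f q r - e <= f q' r']) ->
  extension (ratr q)%:E (ratr r)%:E = f q r.
Proof.
move=> lc; apply/eqP; rewrite eq_le; apply/andP; split.
  apply: extension_le => // q' r'; rewrite !lte_fin !ltr_rat => qq' rr'.
  by apply: f_mono; exact: ltW.
apply/ler_addgt0Pr => e /lc [q' [r' [qq' rr']]].
rewrite lerBlDr => /le_trans; apply; rewrite lerD2r.
by apply: extension_ub; right; exists q', r'; rewrite !lte_fin !ltr_rat.
Qed.

End DistributionExtension.

(* A nonnegative function c on binary words, the last letter read coming first,
   with c w = c (true :: w) + c (false :: w), is the law of a random sequence of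
   letters on [0, 1[ with Lebesgue measure: the words of length n label the
   members of a partition into intervals of lengths c w. *)
Section NestedIntervals.
Context (R : realType) (c : seq bool -> R).
Context (c_ge0 : forall w, 0 <= c w) (c_nil : c [::] = 1).
Context (c_split : forall w, c w = c (true :: w) + c (false :: w)).

Fixpoint left_end (w : seq bool) : R :=
  if w is b :: w' then
    (if b then left_end w' else left_end w' + c (true :: w'))
  else 0.

Definition word_itv (w : seq bool) : set R :=
  `[left_end w, left_end w + c w[%classic.

Lemma word_itvE w z : word_itv w z = (left_end w <= z < left_end w + c w) :> Prop.
Proof. by rewrite /word_itv /= in_itv. Qed.

Lemma word_itv_nil : word_itv [::] = `[0, 1[%classic.
Proof. by rewrite /word_itv /= add0r c_nil. Qed.

Lemma word_itv_split w :
  word_itv w = word_itv (true :: w) `|` word_itv (false :: w).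
Proof.
apply/seteqP; split => z; rewrite /= !word_itvE /= (c_split w).
  move=> /andP[lz zr]; have [zt|tz] := ltP z (left_end w + c (true :: w)).
    by left; apply/andP.
  by right; rewrite -addrA; apply/andP.
have ct := c_ge0 (true :: w); have cf := c_ge0 (false :: w).
case=> /andP[]; move=> lz zr; apply/andP; split; lra.
Qed.

Lemma word_itv_disj w : word_itv (true :: w) `&` word_itv (false :: w) = set0.
Proof.
rewrite -subset0 => z []; rewrite !word_itvE /= => /andP[_ zt] /andP[tz _].
by move: zt; rewrite ltNge tz.
Qed.

Lemma word_itv_cons b w : word_itv (b :: w) `<=` word_itv w.
Proof. by rewrite (word_itv_split w); case: b => z; [left|right]. Qed.

Lemma word_itv_inj w w' z : size w = size w' ->
  word_itv w z -> word_itv w' z -> w = w'.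
Proof.
elim: w w' => [|b w IH] [|b' w'] //= [sw] Jw Jw'.
have E := IH _ sw (word_itv_cons Jw) (word_itv_cons Jw').
move: Jw'; rewrite -E => Jw'.
have := word_itv_disj w; rewrite -subset0 => H.
by case: b b' Jw Jw' => -[] // J1 J2; exfalso; apply: (H z); split.
Qed.

Lemma word_itv_cover n z : `[0, 1[%classic z ->
  exists2 w, size w = n & word_itv w z.
Proof.
rewrite -word_itv_nil => z0; elim: n => [|n [w sw]]; first by exists [::].
rewrite word_itv_split => -[Jw|Jw].
  by exists (true :: w); rewrite //= sw.
by exists (false :: w); rewrite //= sw.
Qed.

Lemma word_itv_sub w : word_itv w `<=` `[0, 1[%classic.
Proof.
elim: w => [|b w IH]; first by rewrite word_itv_nil.
exact: subset_trans (@word_itv_cons b w) IH.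
Qed.

(** The event that letter number n, counted from 0, is [true]. *)
Definition bit_set (n : nat) : set R :=
  \bigcup_(w in [set w | size w = n]) word_itv (true :: w).

Lemma bit_set_cons n b w z : size w = n -> word_itv (b :: w) z ->
  bit_set n z <-> b.
Proof.
move=> sw Jz; split=> [[w' /= sw' Jz']|b1]; last by exists w; move: Jz; rewrite ?b1.
have E : b :: w = true :: w' by apply: word_itv_inj Jz Jz'; rewrite /= sw sw'.
by case: E.
Qed.

Lemma measurable_word_itv w : measurable (word_itv w : set (measurableTypeR R)).
Proof. exact: measurable_itv. Qed.

Lemma measurable_bit_set n : measurable (bit_set n : set (measurableTypeR R)).
Proof.
rewrite /bit_set bigcup_mkcond; apply: countable_bigcupT_measurable => // w.
by case: ifP => _ //; exact: measurable_word_itv.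
Qed.

Lemma lebesgue_word_itv w :
  (@lebesgue_measure R) (word_itv w) = (c w)%:E.
Proof.
rewrite /word_itv lebesgue_measure_itv /= lte_fin; case: ltP.
  by rewrite EFinD addeAC subee // add0e.
by rewrite gerDl => cw; congr EFin; apply/eqP; rewrite eq_le cw c_ge0.
Qed.

End NestedIntervals.

(* The plane is cut along all lines with a rational equation, one after the other;
   a word records the chosen sides, and is weighted by the volume of the resulting
   cell. [lower_set s q] is then the event that the random cell lies below q in
   the coordinate s. *)
Section CutTree.
Context (R : realType) (F : \bar R -> \bar R -> R).
Context (F_volume : forall x x' y y', (x <= x')%E -> (y <= y')%E ->
  0 <= F x' y' - F x y' - F x' y + F x y).
Implicit Types (t : \bar R) (i : \bar R * \bar R)
  (k : (\bar R * \bar R) * (\bar R * \bar R)).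

(** When t lies outside the interval, one half becomes the degenerate [t, t] instead of
    disappearing. Every word thus has a cell, and volumes remain additive without a case
    distinction. *)
Definition cut_itv t (b : bool) i :=
  if b then (Order.min i.1 t, Order.min i.2 t)
  else (Order.max i.1 t, Order.max i.2 t).

(* [s] tells which coordinate is cut, and [b] which side is kept. *)
Definition cut (s : bool) t (b : bool) k :=
  if s then (cut_itv t b k.1, k.2) else (k.1, cut_itv t b k.2).

Definition side (s : bool) k := if s then k.1 else k.2.

Definition volume k := F k.1.2 k.2.2 - F k.1.1 k.2.2 - F k.1.2 k.2.1 + F k.1.1 k.2.1.

Definition proper k := (k.1.1 <= k.1.2)%E && (k.2.1 <= k.2.2)%E.

Lemma proper_side s k : proper k -> ((side s k).1 <= (side s k).2)%E.
Proof. by rewrite /proper => /andP[]; case: s. Qed.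

Lemma volume_ge0 k : proper k -> 0 <= volume k.
Proof. by move=> /andP[k1 k2]; exact: F_volume. Qed.

Lemma volume_degenerate s k : (side s k).1 = (side s k).2 -> volume k = 0.
Proof. by case: k => [[a b] [c d]]; case: s => /= ->; rewrite /volume /=; ring. Qed.

Lemma cut_itv_le t b i : (i.1 <= i.2)%E ->
  ((cut_itv t b i).1 <= (cut_itv t b i).2)%E.
Proof.
move=> ii; case: b => /=; first by rewrite le_min !ge_min ii lexx orbT.
by rewrite ge_max !le_max ii lexx orbT.
Qed.

Lemma proper_cut s t b k : proper k -> proper (cut s t b k).
Proof.
rewrite /proper => /andP[k1 k2].
by case: s; apply/andP; split => //; exact: cut_itv_le.
Qed.

(** The degenerate alternative does occur: cutting an interval below q at some t > q produces
    [t, t]. *)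
Lemma cut_itv_below (q t : \bar R) b i : (i.1 <= i.2)%E ->
  (i.2 <= q)%E \/ i.1 = i.2 ->
  ((cut_itv t b i).2 <= q)%E \/ (cut_itv t b i).1 = (cut_itv t b i).2.
Proof.
move=> ii [iq|E]; last by right; case: b; rewrite /= E.
case: b => /=; first by left; rewrite ge_min iq.
have [ti|it] := leP t i.2; first by left.
by right; rewrite max_r // (le_trans ii) // ltW.
Qed.

Lemma cut_itv_above (q t : \bar R) b i : (i.1 <= i.2)%E ->
  (q <= i.1)%E \/ i.1 = i.2 ->
  (q <= (cut_itv t b i).1)%E \/ (cut_itv t b i).1 = (cut_itv t b i).2.
Proof.
move=> ii [iq|E]; last by right; case: b; rewrite /= E.
case: b => /=; last by left; rewrite le_max iq.
have [it|ti] := leP i.1 t; first by left.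
by right; rewrite min_r // ltW // (lt_le_trans ti).
Qed.

Lemma volume_cut s t k : volume k = volume (cut s t true k) + volume (cut s t false k).
Proof.
case: k => [[a b] [c d]]; rewrite /volume /cut /cut_itv.
by case: s => /=; [case: (leP a t); case: (leP b t)|case: (leP c t); case: (leP d t)];
  move=> _ _; ring.
Qed.

(** The part of a cell inside the quadrant with vertex (q, r) has additive volume too, which drives
    the induction in [lebesgue_lower_set]. *)
Lemma volume_cut_clip s t q r k :
  let clip k := cut true q true (cut false r true k) in
  volume (clip k) = volume (clip (cut s t true k)) + volume (clip (cut s t false k)).
Proof.
case: k => [[a b] [c d]]; rewrite /volume /cut /cut_itv.
by case: s => /=; [case: (leP a t); case: (leP b t)|case: (leP c t); case: (leP d t)];
  move=> _ _; ring.
Qed.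

(** The line at q in coordinate s is cut at step [pickle (s, q)]. Steps that code no pair fall back
    to the line at 0, which is harmless because any cut preserves the total volume. *)
Definition cut_point (n : nat) : bool * rat := odflt (true, 0) (unpickle n).

Fixpoint word_cell (w : seq bool) :=
  if w is b :: w' then
    let: (s, q) := cut_point (size w') in cut s (ratr q)%:E b (word_cell w')
  else ((-oo, +oo), (-oo, +oo))%E.

Definition content w := volume (word_cell w).

Lemma proper_word_cell w : proper (word_cell w).
Proof.
elim: w => [|b w IH]; first by rewrite /proper /= leNye.
by rewrite /=; case: cut_point => s q; exact: proper_cut.
Qed.

Lemma content_ge0 w : 0 <= content w.
Proof. exact/volume_ge0/proper_word_cell. Qed.

Lemma content_split w : content w = content (true :: w) + content (false :: w).
Proof. by rewrite /content /=; case: cut_point => s q; exact: volume_cut. Qed.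

Lemma word_itv_nonempty w z : word_itv content w z -> content w <> 0.
Proof.
rewrite word_itvE => /andP[lz zr] E; rewrite E addr0 in zr.
by move: zr; rewrite ltNge lz.
Qed.

(** A half-open interval that contains a point has positive length; this is how degenerate cells are
    discarded. *)
Lemma word_itv_nondegenerate s w z : word_itv content w z ->
  (side s (word_cell w)).1 <> (side s (word_cell w)).2.
Proof. by move=> /word_itv_nonempty + /volume_degenerate. Qed.

Definition lower_set (s : bool) (q : rat) : set R := bit_set content (pickle (s, q)).

(** Once the line at q has been cut, the cell lies on the side told by the corresponding letter, and
    later cuts keep it there or make it degenerate. *)
Lemma side_lower_set s q w z : (pickle (s, q) < size w)%N ->
  word_itv content w z -> let i := side s (word_cell w) in
  (lower_set s q z -> (i.2 <= (ratr q)%:E)%E) /\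
  (~ lower_set s q z -> ((ratr q)%:E <= i.1)%E).
Proof.
move=> nw Jz /=; have nd := @word_itv_nondegenerate s _ _ Jz.
suff [H1 H2] : let i := side s (word_cell w) in
  (lower_set s q z -> (i.2 <= (ratr q)%:E)%E \/ i.1 = i.2) /\
  (~ lower_set s q z -> ((ratr q)%:E <= i.1)%E \/ i.1 = i.2).
  by split => [/H1[]//|/H2[]//].
elim: w nw Jz {nd} => // b w IH.
rewrite -[size _]/(size w).+1 ltnS leq_eqVlt => /predU1P[E|nw] Jz.
  have Ep : cut_point (size w) = (s, q) by rewrite /cut_point -E pickleK.
  rewrite /= Ep /=.
  have Hb : lower_set s q z <-> b.
    exact: (bit_set_cons content_ge0 content_split (esym E) Jz).
  split=> [/Hb|/(contra_not (proj2 Hb))]; case: b {Jz Hb} => // _.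
    by left; case: s {E Ep IH} => /=; rewrite ge_min lexx orbT.
  by left; case: s {E Ep IH} => /=; rewrite le_max lexx orbT.
rewrite /=; have [IH1 IH2] := IH nw (word_itv_cons content_ge0 content_split Jz).
case: cut_point => s' q'.
have le := proper_side s (proper_word_cell w).
have E : side s (cut s' (ratr q')%:E b (word_cell w)) =
    if s == s' then cut_itv (ratr q')%:E b (side s (word_cell w))
    else side s (word_cell w).
  by case: s {IH IH1 IH2 nw le}; case: s'.
rewrite E; case: ifP => // _; split.
  by move=> /IH1; exact: cut_itv_below.
by move=> /IH2; exact: cut_itv_above.
Qed.

Context (F_total : F +oo%E +oo%E = 1) (F_Ny : forall y, F -oo%E y = 0)
  (F_xN : forall x, F x -oo%E = 0).

Lemma content_nil : content [::] = 1.
Proof. by rewrite /content /volume /= F_total !F_Ny F_xN; ring. Qed.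

Lemma lower_set_sub s q : lower_set s q `<=` `[0, 1[%classic.
Proof.
by move=> z [w _]; exact: (word_itv_sub content_ge0 content_nil content_split).
Qed.

(** In a word long enough to have decided both cuts, a point below q but not below q' would have a
    cell squeezed to width zero. *)
Lemma lower_set_mono s q q' : q <= q' -> lower_set s q `<=` lower_set s q'.
Proof.
move=> qq' z zq; apply: contrapT => zq'.
pose N := (maxn (pickle (s, q)) (pickle (s, q'))).+1.
have [w sw Jz] := word_itv_cover content_ge0 content_nil content_split N
  (lower_set_sub zq).
have [|/(_ zq) H _] := @side_lower_set s q w z _ Jz.
  by rewrite sw ltnS leq_maxl.
have [|_ /(_ zq') H'] := @side_lower_set s q' w z _ Jz.
  by rewrite sw ltnS leq_maxr.
apply: (@word_itv_nondegenerate s _ _ Jz); apply/eqP; rewrite eq_le.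
rewrite (proper_side _ (proper_word_cell w)) /=.
by rewrite (le_trans H) // (le_trans _ H') // lee_fin ler_rat.
Qed.

Lemma measurable_lower_set s q :
  measurable (lower_set s q : set (measurableTypeR R)).
Proof. exact: measurable_bit_set. Qed.

Lemma lebesgue_lower_set q r :
  lebesgue_measure (lower_set true q `&` lower_set false r) =
    (F (ratr q)%:E (ratr r)%:E)%:E.
Proof.
pose clip k := cut true (ratr q)%:E true (cut false (ratr r)%:E true k).
pose S : set (measurableTypeR R) := lower_set true q `&` lower_set false r.
have mS : measurable S by apply: measurableI; exact: measurable_lower_set.
pose N := (maxn (pickle (true, q)) (pickle (false, r))).+1.
(* Induction from the leaves to the root: at depth N both lines have been cut, so a cell of positive
   volume lies either inside the quadrant or outside. *)
suff H n w : (size w + n)%N = N ->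
    lebesgue_measure (word_itv content w `&` S) = (volume (clip (word_cell w)))%:E.
  have := H N [::] erefl; rewrite (word_itv_nil content_nil) setIidr; last first.
    by move=> z [/lower_set_sub].
  move=> ->; rewrite /volume /clip /cut /cut_itv /=.
  have minN (t : \bar R) : Order.min -oo%E t = -oo%E by rewrite min_l ?leNye.
  have minY (t : \bar R) : Order.min +oo%E t = t by rewrite min_r ?leey.
  by rewrite !minN !minY F_xN !F_Ny; congr EFin; ring.
elim: n w => [|n IH] w; last first.
  move=> sw; rewrite (word_itv_split content_ge0 content_split) setIUl measureU.
  - transitivity ((volume (clip (word_cell (true :: w))))%:E +
      (volume (clip (word_cell (false :: w))))%:E).
      by congr (_ + _); apply: IH; rewrite -sw addSnnS.
    by rewrite /=; case: cut_point => s t; rewrite -EFinD -volume_cut_clip.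
  - by apply: measurableI => //; exact: measurable_word_itv.
  - by apply: measurableI => //; exact: measurable_word_itv.
  - by rewrite setIACA word_itv_disj set0I.
rewrite addn0 => sw.
(* A cell of volume zero has an empty interval, and its part in the quadrant, being a nonnegative
   summand of that volume, vanishes as well. *)
have [c0|c0] := eqVneq (content w) 0.
  have -> : word_itv content w = set0.
    by rewrite -subset0 => z /word_itv_nonempty.
  rewrite set0I measure0; congr EFin; apply/esym/eqP; rewrite eq_le.
  have pk := proper_word_cell w.
  rewrite volume_ge0 ?andbT; last by do ?apply: proper_cut.
  rewrite -c0 /content (volume_cut false (ratr r)%:E (word_cell w)).
  rewrite (volume_cut true (ratr q)%:E (cut false _ true _)) -addrA lerDl.
  by rewrite addr_ge0 // volume_ge0 //; do ?apply: proper_cut.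
have [z Jz] : exists z, word_itv content w z.
  exists (left_end content w); rewrite word_itvE lexx ltrDl lt_neqAle eq_sym c0.
  exact: content_ge0.
have nT : (pickle (true, q) < size w)%N by rewrite sw ltnS leq_maxl.
have nF : (pickle (false, r) < size w)%N by rewrite sw ltnS leq_maxr.
(* The points of one interval share a cell, and a nondegenerate cell cannot lie on both sides of a
   line. *)
have const s p : (pickle (s, p) < size w)%N -> forall z',
    word_itv content w z' -> lower_set s p z' -> lower_set s p z.
  move=> np z' Jz' Sz'; apply: contrapT => Sz.
  have [/(_ Sz') H _] := side_lower_set np Jz'.
  have [_ /(_ Sz) H'] := side_lower_set np Jz.
  apply: (@word_itv_nondegenerate s _ _ Jz); apply/eqP; rewrite eq_le.
  by rewrite (proper_side _ (proper_word_cell w)) /= (le_trans H).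
have const' s p : (pickle (s, p) < size w)%N -> forall z',
    word_itv content w z' -> lower_set s p z -> lower_set s p z'.
  move=> np z' Jz' Sz'; apply: contrapT => Sz.
  have [/(_ Sz') H _] := side_lower_set np Jz.
  have [_ /(_ Sz) H'] := side_lower_set np Jz'.
  apply: (@word_itv_nondegenerate s _ _ Jz); apply/eqP; rewrite eq_le.
  by rewrite (proper_side _ (proper_word_cell w)) /= (le_trans H).
have [[Sq Sr]|Sz] := pselect (S z).
  rewrite setIidl; last by move=> z' Jz'; split; exact: const'.
  rewrite (lebesgue_word_itv content_ge0) /content.
  have [/(_ Sq) H _] := side_lower_set nT Jz.
  have [/(_ Sr) H' _] := side_lower_set nF Jz.
  have /andP[k1 k2] := proper_word_cell w.
  rewrite /clip /cut /cut_itv /=.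
  by rewrite !min_l ?(le_trans k1) ?(le_trans k2).
have -> : word_itv content w `&` S = set0.
  by rewrite -subset0 => z' [Jz' [Sq Sr]]; apply: Sz; split; exact: const Jz' _.
rewrite measure0; congr EFin; apply/esym.
have [Sq|Sq] := pselect (lower_set true q z); last first.
  have [_ /(_ Sq) H] := side_lower_set nT Jz.
  have /andP[k1 k2] := proper_word_cell w.
  by apply: (@volume_degenerate true) => /=; rewrite !min_r // (le_trans H).
have [_ H] := side_lower_set nF Jz.
have /H{}H : ~ lower_set false r z by move=> Sr; apply: Sz.
have /andP[k1 k2] := proper_word_cell w.
by apply: (@volume_degenerate false) => /=; rewrite !min_r // (le_trans H).
Qed.

End CutTree.

Definition quadrant (R : realType) (s t : R) : set (R * R) :=
  `]-oo, s[%classic `*` `]-oo, t[%classic.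

(** * The law of the random point *)

Section DistributionMeasure.
Context (R : realType) (f : rat -> rat -> R).
Context (f_ge0 : forall q r, 0 <= f q r) (f_le1 : forall q r, f q r <= 1).
Context (f_mono : forall q q' r r' : rat, q <= q' -> r <= r' -> f q r <= f q' r').
Context (f_volume : forall q q' r r' : rat, q <= q' -> r <= r' ->
  0 <= f q' r' - f q r' - f q' r + f q r).
Context (f_left : forall (q r : rat) (e : R), 0 < e ->
  exists q' r' : rat, [/\ q' < q, r' < r & f q r - e <= f q' r']).
Context (f_Ny : forall r (e : R), 0 < e -> exists q, f q r <= e).
Context (f_xN : forall q (e : R), 0 < e -> exists r, f q r <= e).
Context (f_total : forall e : R, 0 < e -> exists q r, 1 - e <= f q r).

Local Notation F := (extension f).
Local Notation L := (lower_set F).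
Local Notation T := (measurableTypeR R).

Let F_volume x x' y y' : (x <= x')%E -> (y <= y')%E ->
  0 <= F x' y' - F x y' - F x' y + F x y.
Proof. exact: extension_volume. Qed.

Let F_Ny y : F -oo%E y = 0. Proof. exact: extension_Ny. Qed.

Let F_xN x : F x -oo%E = 0. Proof. exact: extension_xN. Qed.

Let F_rat q r : F (ratr q)%:E (ratr r)%:E = f q r.
Proof. by apply: extension_rat => // e; exact: f_left. Qed.

Let F_total : F +oo%E +oo%E = 1.
Proof.
apply/eqP; rewrite eq_le extension_le //=.
apply/ler_addgt0Pr => e /f_total [q [r]].
rewrite lerBlDr => /le_trans; apply; rewrite lerD2r.
by apply: extension_ub => //; right; exists q, r; rewrite !ltry.
Qed.

Let L_sub s q : L s q `<=` `[0, 1[%classic.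
Proof. exact: lower_set_sub. Qed.

Let L_mono s q q' : q <= q' -> L s q `<=` L s q'.
Proof. exact: lower_set_mono. Qed.

Let mL s q : measurable (L s q : set T).
Proof. exact: measurable_lower_set. Qed.

Let leb_L q r : lebesgue_measure (L true q `&` L false r) = (f q r)%:E.
Proof. by rewrite lebesgue_lower_set // F_rat. Qed.

(* The coordinates of the random point whose law is the desired measure. *)
Definition coordinate (s : bool) (z : T) : \bar R :=
  ereal_inf [set (ratr q)%:E | q in [set q | L s q z]].

Let coordinate_lt s z (x : \bar R) : (coordinate s z < x)%E <->
  exists2 q, ((ratr q)%:E < x)%E & L s q z.
Proof.
split=> [/ereal_inf_lt[_ [q Lq <-] qx]|[q qx Lq]]; first by exists q.
by apply: le_lt_trans qx; apply: ereal_inf_lbound; exists q.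
Qed.

Let measurable_coordinate s : measurable_fun setT (coordinate s).
Proof.
apply: (measurability _ (ErealGenInftyO.measurableE R)) => // _ [_ [x ->] <-].
rewrite setTI (_ : _ @^-1` _ =
  \bigcup_q (if (ratr q)%:E < x%:E then L s q else set0)%E); last first.
  apply/seteqP; split => z /=; rewrite in_itv /=.
    by move=> /coordinate_lt[q qx Lq]; exists q; rewrite ?qx.
  by move=> [q _]; case: ifP => // qx Lq; apply/coordinate_lt; exists q.
by apply: bigcupT_measurable_rat => q; case: ifP.
Qed.

(** [fine] sends infinite coordinates to 0. On [0, 1[, where the law is taken, this affects a
    negligible set only ([negligible_infinite]). *)
Let point (z : T) : R * R := (fine (coordinate true z), fine (coordinate false z)).

Let measurable_point : measurable_fun setT (point : T -> T * T).
Proof.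
by apply: measurable_fun_pair;
  apply: measurableT_comp (measurable_coordinate _); exact: fine_measurable.
Qed.

Let infinite : set T :=
  [set z | `[0, 1[%classic z /\
     (exists s, coordinate s z = +oo%E \/ coordinate s z = -oo%E)].

Let leb_itv01 : lebesgue_measure (`[0 : R, 1[%classic) = 1%E.
Proof. by rewrite lebesgue_measure_itv /= lte_fin ltr01 oppr0 adde0. Qed.

(** A coordinate +oo puts z outside all the sets [L true q]&[L false r] (the case [N0]), whose
    measures come close to 1. If no coordinate is +oo but one is -oo, then z lies in these sets for
    some fixed rational in the other coordinate and all rationals in this one ([N1], [N2]), and
    their measures come close to 0. *)
Let negligible_infinite : lebesgue_measure.-negligible infinite.
Proof.
pose N0 : set T := `[0, 1[%classic `\` \bigcup_q \bigcup_r (L true q `&` L false r).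
pose N1 r : set T := \bigcap_q (L true q `&` L false r).
pose N2 q : set T := \bigcap_r (L true q `&` L false r).
have mU : measurable (\bigcup_q \bigcup_r (L true q `&` L false r) : set T).
  apply: bigcupT_measurable_rat => q; apply: bigcupT_measurable_rat => r.
  exact: measurableI.
have m01 : measurable (`[0, 1[%classic : set T) by exact: measurable_itv.
have small (A : set T) : measurable A ->
    (forall e : R, 0 < e -> (lebesgue_measure A <= e%:E)%E) ->
    lebesgue_measure.-negligible A.
  move=> mA He; apply/negligibleP => //; apply/eqP; rewrite -measure_le0.
  by apply/lee_addgt0Pr => e /He; rewrite add0e.
have mB q r : measurable (L true q `&` L false r : set T) by exact: measurableI.
have H0 : lebesgue_measure.-negligible N0.
  apply: small => [|e /f_total[q [r Hqr]]]; first exact: measurableD.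
  apply: (@le_trans _ _ (lebesgue_measure
      (`[0 : R, 1[%classic `\` (L true q `&` L false r)))).
    apply: le_measure; rewrite ?inE; try exact: measurableD.
    by apply: setDS => z Lz; exists q => //; exists r.
  rewrite measureD //=; last by rewrite leb_itv01 ltry.
  rewrite setIidr; last by move=> z [/L_sub].
  by rewrite leb_itv01 leb_L -EFinB lee_fin lerBlDr -lerBlDl.
have H1 r : lebesgue_measure.-negligible (N1 r).
  have mN : measurable (N1 r).
    rewrite -[N1 r]setCK setC_bigcap; apply/measurableC.
    by apply: bigcupT_measurable_rat => q; exact: measurableC.
  apply: small => // e /(f_Ny r)[q Hq].
  apply: (@le_trans _ _ (f q r)%:E); last by rewrite lee_fin.
  by rewrite -leb_L; apply: le_measure; rewrite ?inE //; exact: bigcap_inf.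
have H2 q : lebesgue_measure.-negligible (N2 q).
  have mN : measurable (N2 q).
    rewrite -[N2 q]setCK setC_bigcap; apply/measurableC.
    by apply: bigcupT_measurable_rat => r; exact: measurableC.
  apply: small => // e /(f_xN q)[r Hr].
  apply: (@le_trans _ _ (f q r)%:E); last by rewrite lee_fin.
  by rewrite -leb_L; apply: le_measure; rewrite ?inE //; exact: bigcap_inf.
pose qn n : rat := odflt 0 (unpickle n).
apply: (@negligibleS _ _ _ _ (N0 `|` (\bigcup_n N1 (qn n) `|` \bigcup_n N2 (qn n)))).
  move=> z [z01 [s Hs]]; have [[q _ [r _ Lqr]]|] :=
    pselect ((\bigcup_q \bigcup_r (L true q `&` L false r)) z); last first.
    by move=> nL; left.
  right; case: Hs => Hs.
    have : (coordinate s z < +oo)%E.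
      apply/coordinate_lt; exists (if s then q else r); first by rewrite ltry.
      by case: (s) Lqr => -[].
    by rewrite Hs.
  have Ls p : L s p z.
    have : (coordinate s z < (ratr p)%:E)%E by rewrite Hs ltNyr.
    move/coordinate_lt => [p' pp' Lp']; apply: L_mono Lp'.
    by move: pp'; rewrite lte_fin ltr_rat => /ltW.
  case: s {Hs} Ls => Ls.
    left; exists (pickle r) => //; rewrite /qn pickleK /= => p _.
    by split => //; exact: Lqr.2.
  right; exists (pickle q) => //; rewrite /qn pickleK /= => p _.
  by split => //; exact: Lqr.1.
by apply: negligibleU => //; apply: negligibleU; apply: negligible_bigcup.
Qed.

(** The measure is the law of [point]. Up to a negligible set, the event that the point falls into
    the quadrant at (q, r) is squeezed between the lower sets of q' < q, r' < r and those of q, r;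
    left continuity of f closes the gap. *)
Lemma distribution_measure :
  exists mu : {measure set (T * T) -> \bar R}, mu setT = 1%E /\
    forall q r, mu (quadrant (ratr q) (ratr r)) = (f q r)%:E.
Proof.
have m01 : measurable (`[0, 1[%classic : set T) by exact: measurable_itv.
exists (measure_function_pushforward__canonical__measure_function_Measure
  (measure_function_mrestr__canonical__measure_function_Measure
     (@lebesgue_measure R) m01) measurable_point).
rewrite /= /pushforward /mrestr; split.
  by rewrite preimage_setT setTI leb_itv01.
move=> q r; set A := _ `&` _.
have mQ : measurable (quadrant (ratr q) (ratr r) : set (T * T)).
  by apply: measurableX; exact: measurable_itv.
have mA : measurable (A : set T).
  by apply: measurableI => //; rewrite -[X in measurable X]setTI; exact: measurable_point.
have finite z s : `[0, 1[%classic z -> ~ infinite z -> coordinate s z \is a fin_num.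
  move=> z01 nz; rewrite fin_numE; apply/andP; split; apply/eqP => E.
    by apply: nz; split => //; exists s; right.
  by apply: nz; split => //; exists s; left.
have up : A `<=` (L true q `&` L false r) `|` infinite.
  move=> z [[/=]]; rewrite !in_itv /= => zq zr z01.
  have [?|nz] := pselect (infinite z); [by right|left].
  have E s : coordinate s z = (fine (coordinate s z))%:E.
    by rewrite fineK // finite.
  split.
    have /coordinate_lt[q'] : (coordinate true z < (ratr q)%:E)%E by rewrite E lte_fin.
    by rewrite lte_fin ltr_rat => /ltW/L_mono; apply.
  have /coordinate_lt[r'] : (coordinate false z < (ratr r)%:E)%E by rewrite E lte_fin.
  by rewrite lte_fin ltr_rat => /ltW/L_mono; apply.
have low q' r' : q' < q -> r' < r -> (L true q' `&` L false r') `<=` A `|` infinite.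
  move=> qq' rr' z [Lq Lr].
  have [?|nz] := pselect (infinite z); [by right|left].
  have z01 : `[0, 1[%classic z by exact: L_sub Lq.
  have E s : coordinate s z = (fine (coordinate s z))%:E.
    by rewrite fineK // finite.
  split => //; split; rewrite /= in_itv /= -lte_fin -E; apply/coordinate_lt.
    by exists q' => //; rewrite lte_fin ltr_rat.
  by exists r' => //; rewrite lte_fin ltr_rat.
have [N [mN N0 infN]] := negligible_infinite.
have mB q' r' : measurable (L true q' `&` L false r' : set T) by exact: measurableI.
have mono B C : measurable (B : set T) -> measurable (C : set T) ->
    B `<=` C `|` infinite -> (lebesgue_measure B <= lebesgue_measure C)%E.
  move=> mB' mC BC; apply: (@le_trans _ _ (lebesgue_measure (C `|` N))).
    apply: le_measure; rewrite ?inE //; first exact: measurableU.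
    by apply: subset_trans BC _; exact: setUS.
  apply: le_trans (measureU2 lebesgue_measure mC mN) _.
  by rewrite [X in (_ + X)%E]N0 adde0.
apply/eqP; rewrite eq_le; apply/andP; split.
  by rewrite -leb_L; exact: mono.
apply/lee_addgt0Pr => e /(f_left q r)[q' [r' [qq' rr' H]]].
have := mono _ _ (mB q' r') mA (low _ _ qq' rr').
rewrite leb_L => /(leeD2r e%:E); apply: le_trans.
by rewrite -EFinD lee_fin -lerBlDr.
Qed.

End DistributionMeasure.

(** * Measures with values in G *)

Section BorelQuadrant.
Context (R : realType).
Local Notation T := (measurableTypeR R).

(** A countable pi-system generating the Borel sets, so that one generic chain can control the
    values of Phi on all of it. *)
Definition rational_quadrants : set (set (R * R)) :=
  [set A | exists q r : rat, A = quadrant (ratr q) (ratr r)].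

Lemma quadrantI (s t s' t' : R) :
  quadrant s t `&` quadrant s' t' = quadrant (Order.min s s') (Order.min t t').
Proof.
apply/seteqP; split => -[x y]; rewrite /quadrant /= !in_itv /= !lt_min.
  by move=> [[-> ->] [-> ->]].
by move=> [/andP[-> ->] /andP[-> ->]].
Qed.

Lemma rational_quadrants_setI : setI_closed rational_quadrants.
Proof.
move=> _ _ [q [r ->]] [q' [r' ->]]; exists (Order.min q q'), (Order.min r r').
by rewrite quadrantI; congr quadrant; rewrite !minElt ltr_rat; case: ifP.
Qed.

Lemma open_quadrant (s t : R) : open (quadrant s t).
Proof.
rewrite (_ : quadrant s t = fst @^-1` `]-oo, s[%classic `&` snd @^-1` `]-oo, t[%classic) //.
apply: openI; apply: open_comp => [p _|]; [exact: cvg_fst|exact: lray_open| |].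
  exact: cvg_snd.
exact: lray_open.
Qed.

Lemma borel2_quadrant (s t : R) : borel2 (quadrant s t).
Proof. by apply: sub_sigma_algebra; exact: open_quadrant. Qed.

Lemma borel2T : borel2 (setT : set (R * R)).
Proof. by apply: sub_sigma_algebra; exact: openT. Qed.

Lemma borel2D (A B : set (R * R)) : borel2 A -> borel2 B -> borel2 (A `\` B).
Proof.
exact: (@measurableD _ (g_sigma_algebraType [set A : set (R * R) | open A])).
Qed.

Lemma borel2U (A B : set (R * R)) : borel2 A -> borel2 B -> borel2 (A `|` B).
Proof.
exact: (@measurableU _ (g_sigma_algebraType [set A : set (R * R) | open A])).
Qed.

Lemma borel2_bigcup (A : nat -> set (R * R)) : (forall i, borel2 (A i)) ->
  borel2 (\bigcup_i A i).
Proof.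
have [_ _ H] := smallest_sigma_algebra setT [set A : set (R * R) | open A].
exact: H.
Qed.

Lemma borel2_rational : @borel2 R `<=` <<s rational_quadrants >>.
Proof.
apply: smallest_sub; first exact: smallest_sigma_algebra.
move=> A oA.
have [s0 sD sU] : sigma_algebra setT (<<s rational_quadrants >>).
  exact: smallest_sigma_algebra.
have sDl B C : <<s rational_quadrants >> B -> <<s rational_quadrants >> C ->
    <<s rational_quadrants >> (B `\` C).
  exact: (@measurableD _ (g_sigma_algebraType rational_quadrants)).
have Q q r : <<s rational_quadrants >> (quadrant (ratr q : R) (ratr r)).
  by apply: sub_sigma_algebra; exists q, r.
(* The rectangle [a, b[ x [c, d[ as a difference of quadrants; an open set is the union of the
   countably many rational ones that it contains. *)
pose B (k : rat * rat * (rat * rat)) : set (R * R) :=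
  (quadrant (ratr k.1.2) (ratr k.2.2) `\` quadrant (ratr k.1.1) (ratr k.2.2))
  `\` quadrant (ratr k.1.2) (ratr k.2.1).
have BE k x y : B k (x, y) <-> (ratr k.1.1 <= x < ratr k.1.2) /\
    (ratr k.2.1 <= y < ratr k.2.2).
  rewrite /B /quadrant /= !in_itv /=; split.
    move=> [[[x2 y2] nx] ny]; rewrite x2 y2 !andbT; split.
      by rewrite leNgt; apply/negP => x1; apply: nx.
    by rewrite leNgt; apply/negP => y1; apply: ny.
  move=> [/andP[x1 x2] /andP[y1 y2]]; split; first split => //.
    by move=> [+ _]; rewrite ltNge x1.
  by move=> [_]; rewrite ltNge y1.
pose C k := if `[< B k `<=` A >] then B k else set0.
have -> : A = \bigcup_k C k.
  apply/seteqP; split => [[x y] Axy|p [k _]]; last first.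
    by rewrite /C; case: asboolP => // BA /BA.
  have : nbhs (x, y) A by apply: open_nbhs_nbhs; split.
  move=> /nbhs_ballP[e /= e0 He].
  have xe (z : R) : z - e < z by rewrite ltrBlDr ltrDl.
  have ex (z : R) : z < z + e by rewrite ltrDl.
  have [a ax] := @rat_in_itvoo R (x - e) x (xe x).
  have [b bx] := @rat_in_itvoo R x (x + e) (ex x).
  have [c cy] := @rat_in_itvoo R (y - e) y (xe y).
  have [d dy] := @rat_in_itvoo R y (y + e) (ex y).
  move: ax; rewrite in_itv /= => /andP[a1 a2].
  move: bx; rewrite in_itv /= => /andP[b1 b2].
  move: cy; rewrite in_itv /= => /andP[c1 c2].
  move: dy; rewrite in_itv /= => /andP[d1 d2].
  exists ((a, b), (c, d)) => //; rewrite /C asboolT.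
    by apply/BE; rewrite /= b1 d1 (ltW a2) (ltW c2).
  move=> [x' y'] /BE /= [/andP[ax xb] /andP[cy yd]]; apply: He.
  split; rewrite /ball /= ltr_distlC; apply/andP; split.
  - exact: lt_le_trans ax.
  - exact: lt_trans b2.
  - exact: lt_le_trans cy.
  - exact: lt_trans d2.
apply: (@countable_bigcupT_measurable _ (g_sigma_algebraType rational_quadrants)).
  by [].
move=> k; rewrite /C; case: asboolP => _; last exact: s0.
by apply: (sDl) => //; exact: sDl.
Qed.

Lemma borel2_measurable (A : set (T * T)) : borel2 A -> measurable A.
Proof.
move=> /borel2_rational; apply: smallest_sub A; first exact: sigma_algebra_measurable.
by move=> _ [q [r ->]]; apply: measurableX; exact: measurable_itv.
Qed.

End BorelQuadrant.

Section VectorMeasure.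
Context (R : realType) (G : porderZmodType) (Gpo : po_group G)
  (Gdir : directed G) (Gsigma : monotone_sigma_complete G)
  (Gint : interpolation G) (u : G) (u0 : 0 <= u).
Local Notation T := (measurableTypeR R).
Local Notation h := (chain_value u R).
Local Notation bounded := (po_bounded u).
Implicit Types (x y z g : G) (w : nat -> G) (A B : set (R * R)).

Lemma chain_value_mono w x y : chain u w -> bounded x -> bounded y ->
  x <= y -> h w x <= h w y.
Proof.
move=> cw bx by_ xy; have byx := po_boundedB Gpo by_ bx.
have := chain_value_superadd R Gpo Gdir Gsigma Gint u0 cw bx byx.
rewrite addrCA subrr addr0; apply: le_trans; rewrite lerDl.
apply: (chain_value_ge0 _ Gpo Gdir Gsigma Gint u0) => //.
by apply: (le_sub_eq Gpo xy); abel.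
Qed.

Lemma inf0_subr x (y : nat -> G) : (forall g, (forall n, y n <= g) -> x <= g) ->
  forall z, (forall n, z <= x - y n) -> z <= 0.
Proof.
move=> xsup z zxy; have : x <= x - z.
  by apply: xsup => n; apply: (le_sub_eq Gpo (zxy n)); abel.
by move/(le_sub_eq Gpo); apply; abel.
Qed.

Lemma generically_value_sup x (y : nat -> G) : bounded x ->
  (forall n, bounded (y n)) -> nondecreasing_seq y -> (forall n, y n <= x) ->
  (forall g, (forall n, y n <= g) -> x <= g) ->
  generically u (fun w => forall e : R, 0 < e -> exists n, h w x - e <= h w (y n)).
Proof.
move=> bx by_ yd yx xsup.
have xyd : nonincreasing_seq (fun n => x - y n).
  by move=> m n mn; apply: (le_sub_eq Gpo (yd _ _ mn)); abel.
have xy0 n : 0 <= x - y n by apply: (le_sub_eq Gpo (yx n)); abel.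
have bxy n : bounded (x - y n) by exact: po_boundedB.
have G1 := generically_value_inf0 R Gpo Gdir Gsigma Gint u0 bxy xyd xy0
  (inf0_subr xsup).
have G2 := generically_all
  (fun n => generically_valueB R Gpo Gdir Gsigma Gint u0 bx (by_ n)).
apply: generically_impl (generically_and G1 G2) _ => w _ [H1 H2] e e0.
by have [n] := H1 e e0; exists n; rewrite lerBlDl -lerBlDr -H2.
Qed.

Context (Phi : R -> R -> G).
Context (Phi_ge0 : forall s t, 0 <= Phi s t) (Phi_le : forall s t, Phi s t <= u).
Context (Phi_mono : forall s s' t t', s <= s' -> t <= t' -> Phi s t <= Phi s' t').
Context (Phi_volume : forall s s' t t', s <= s' -> t <= t' ->
  0 <= Phi s' t' - Phi s t' - Phi s' t + Phi s t).
Context (Phi_left : forall s t g,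
  (forall n, Phi (s - n.+1%:R^-1) (t - n.+1%:R^-1) <= g) -> Phi s t <= g).
Context (Phi_Ny : forall t g, (forall n, g <= Phi (- n%:R) t) -> g <= 0).
Context (Phi_xN : forall s g, (forall n, g <= Phi s (- n%:R)) -> g <= 0).
Context (Phi_total : forall g, (forall n, Phi n%:R n%:R <= g) -> u <= g).

Let bPhi s t : bounded (Phi s t).
Proof. by apply: (po_bounded_itv Gpo u0); rewrite Phi_ge0 Phi_le. Qed.

Let bu : bounded u.
Proof. by apply: (po_bounded_itv Gpo u0); rewrite u0 lexx. Qed.

Let f w (q r : rat) : R := h w (Phi (ratr q) (ratr r)).

Let represented w (mu : {measure set (T * T) -> \bar R}) :=
  mu setT = 1%E /\ forall q r, mu (quadrant (ratr q) (ratr r)) = (f w q r)%:E.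

Let ratr_invn (q : rat) (n : nat) : ratr (q - n.+1%:R^-1) = ratr q - n.+1%:R^-1 :> R.
Proof. by rewrite rmorphB /= fmorphV /= rmorph_nat. Qed.

Let generically_represented :
  generically u (fun w => exists mu, represented w mu).
Proof.
pose I := (rat * rat * (rat * rat))%type.
have G1 := generically_all (fun k : I =>
  generically_valueD R Gpo Gdir Gsigma Gint u0
    (bPhi (ratr k.1.1) (ratr k.1.2)) (bPhi (ratr k.2.1) (ratr k.2.2))).
have Vn_le m n : (m <= n)%N -> n.+1%:R^-1 <= m.+1%:R^-1 :> R.
  by move=> mn; rewrite lef_pV2 ?posrE ?ltr0n // ler_nat.
have G2 : generically u (fun w => forall (k : rat * rat) (e : R), 0 < e ->
    exists n, h w (Phi (ratr k.1) (ratr k.2)) - e <=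
      h w (Phi (ratr k.1 - n.+1%:R^-1) (ratr k.2 - n.+1%:R^-1))).
  apply: generically_all => k; apply: generically_value_sup => //.
  - by move=> m n mn; apply: Phi_mono; rewrite lerD2l lerN2 Vn_le.
  - by move=> n; apply: Phi_mono; rewrite gerBl invr_ge0 ler0n.
  - exact: Phi_left.
have G3 : generically u (fun w => forall (r : rat) (e : R), 0 < e ->
    exists n, h w (Phi (- n%:R) (ratr r)) <= e).
  apply: generically_all => r.
  apply: (generically_value_inf0 R Gpo Gdir Gsigma Gint u0) => //.
    by move=> m n mn; apply: Phi_mono; rewrite // lerN2 ler_nat.
  exact: Phi_Ny.
have G4 : generically u (fun w => forall (q : rat) (e : R), 0 < e ->
    exists n, h w (Phi (ratr q) (- n%:R)) <= e).
  apply: generically_all => q.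
  apply: (generically_value_inf0 R Gpo Gdir Gsigma Gint u0) => //.
    by move=> m n mn; apply: Phi_mono; rewrite // lerN2 ler_nat.
  exact: Phi_xN.
have G5 : generically u (fun w => forall (e : R), 0 < e ->
    exists n, h w u - e <= h w (Phi n%:R n%:R)).
  apply: generically_value_sup => //.
  by move=> m n mn; apply: Phi_mono; rewrite ler_nat.
have G12 := generically_and G1 G2; have G34 := generically_and G3 G4.
apply: generically_impl (generically_and (generically_and G12 G34) G5) _.
move=> w cw [[[H1 H2] [H3 H4]] H5].
have ratr_nat (n : nat) : ratr n%:R = n%:R :> R by rewrite rmorph_nat.
have hmono x y : bounded x -> bounded y -> x <= y -> h w x <= h w y.
  exact: chain_value_mono.
apply: distribution_measure; rewrite /f.
- by move=> q r; apply: (chain_value_ge0 _ Gpo Gdir Gsigma Gint u0).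
- move=> q r; rewrite -(chain_value_unit R Gpo Gdir Gsigma Gint u0 cw).
  exact: hmono.
- by move=> q q' r r' qq' rr'; apply: hmono => //; apply: Phi_mono; rewrite ler_rat.
- move=> q q' r r' qq' rr'.
  (* In this form of the volume condition, superadditivity bounds the value of the left side from
     below, and generic additivity evaluates the right side. *)
  have V : Phi (ratr q) (ratr r') + Phi (ratr q') (ratr r) <=
      Phi (ratr q') (ratr r') + Phi (ratr q) (ratr r).
    have := @Phi_volume (ratr q) (ratr q') (ratr r) (ratr r').
    by rewrite !ler_rat => /(_ qq' rr')/(le_sub_eq Gpo); apply; abel.
  have := hmono _ _ (po_boundedD Gpo (bPhi _ _) (bPhi _ _))
    (po_boundedD Gpo (bPhi _ _) (bPhi _ _)) V.
  rewrite (H1 ((q', r'), (q, r))).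
  have := chain_value_superadd R Gpo Gdir Gsigma Gint u0 cw
    (bPhi (ratr q) (ratr r')) (bPhi (ratr q') (ratr r)).
  have aux (a b c d : R) : a + b <= c + d -> 0 <= c - a - b + d by lra.
  by move=> /le_trans H /H /aux.
- move=> q r e e0; have [n Hn] := H2 (q, r) e e0.
  exists (q - n.+1%:R^-1), (r - n.+1%:R^-1).
  by rewrite !ratr_invn !gtrBl !invr_gt0 !ltr0n.
- move=> r e e0; have [n Hn] := H3 r e e0; exists (- n%:R).
  by rewrite rmorphN /= ratr_nat.
- move=> r e e0; have [n Hn] := H4 r e e0; exists (- n%:R).
  by rewrite rmorphN /= ratr_nat.
- move=> e e0; have [n Hn] := H5 e e0; exists n%:R, n%:R.
  by rewrite ratr_nat; rewrite (chain_value_unit _ Gpo Gdir Gsigma Gint u0 cw) in Hn.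
Qed.

Lemma vector_measure : exists m : set (R * R) -> G,
  [/\ m setT = u, forall A, borel2 A -> 0 <= m A,
      forall A B, borel2 A -> borel2 B -> A `&` B = set0 ->
        m (A `|` B) = m A + m B,
      forall A : nat -> set (R * R), (forall i, borel2 (A i)) ->
        nondecreasing_seq A ->
        supremums (range (fun i => m (A i))) (m (\bigcup_i A i))
    & forall s t, m (quadrant s t) = Phi s t].
Proof.
(* The measures are chosen before any Borel set is considered; sequences without a representing
   measure get the zero measure. *)
have /choice[mu mu_rep] : forall w, exists mu : {measure set (T * T) -> \bar R},
    (exists mu', represented w mu') -> represented w mu.
  move=> w; have [[mu Hmu]|nmu] := pselect (exists mu', represented w mu').
    by exists mu.
  by exists [the measure _ _ of mzero] => /nmu.
have gen_mu : generically u (fun w => represented w (mu w)).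
  by apply: generically_impl generically_represented _ => w _; exact: mu_rep.
(* The dense sets hidden here may vary with A and x. Each step below involves countably many such
   statements, so their chains can be intersected. *)
pose rep A x := generically u (fun w => mu w A = (h w x)%:E).
have bx x : 0 <= x <= u -> bounded x by exact: po_bounded_itv.
have rep_le A B x y : borel2 A -> borel2 B -> A `<=` B -> rep A x -> rep B y ->
    bounded x -> bounded y -> x <= y.
  move=> /borel2_measurable mA /borel2_measurable mB AB rA rB bndx bndy.
  suff : x - y <= 0 by move/(le_sub_eq Gpo); apply; abel.
  apply: (generically_value_le0 Gpo Gdir Gsigma Gint u0 (R := R)).
    exact: po_boundedB.
  have gB := generically_valueB R Gpo Gdir Gsigma Gint u0 bndx bndy.
  apply: generically_impl (generically_and gB (generically_and rA rB)) _.
  move=> w _ [-> [Aw Bw]]; rewrite subr_le0 -lee_fin -Aw -Bw.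
  by apply: le_measure; rewrite ?inE.
have rep_inj A x y : borel2 A -> rep A x -> rep A y -> bounded x -> bounded y ->
    x = y.
  move=> bA rx ry bndx bndy; apply/eqP; rewrite eq_le.
  by rewrite (rep_le A A x y) // (rep_le A A y x).
have repD A B x y : borel2 A -> borel2 B -> B `<=` A -> rep A x -> rep B y ->
    bounded x -> bounded y -> rep (A `\` B) (x - y).
  move=> /borel2_measurable mA /borel2_measurable mB BA rA rB bndx bndy.
  have gB := generically_valueB R Gpo Gdir Gsigma Gint u0 bndx bndy.
  apply: generically_impl (generically_and gB (generically_and rA rB)) _.
  move=> w _ [-> [Aw Bw]].
  have Afin : (mu w A < +oo)%E by rewrite Aw ltry.
  rewrite measureD //; transitivity (mu w A - mu w B)%E.
    by congr (_ - mu w _)%E; exact: setIidr.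
  by rewrite Aw Bw.
(* The supremum exists in G by monotone completeness; generic values preserve it, just as the
   measures are continuous along increasing unions. *)
have rep_sup (A : nat -> set (R * R)) (x : nat -> G) : (forall i, borel2 (A i)) ->
    nondecreasing_seq A -> (forall i, 0 <= x i <= u) -> (forall i, rep (A i) (x i)) ->
    exists y, [/\ 0 <= y <= u, rep (\bigcup_i A i) y & supremums (range x) y].
  move=> bA Ainc x0u rx.
  have xinc : nondecreasing_seq x.
    move=> i j ij; apply: (rep_le (A i) (A j)) => //; try exact: bx.
    by apply/subsetPset/Ainc.
  have xu i : x i <= u by have /andP[] := x0u i.
  have [y [yub ylub]] : exists y, supremums (range x) y.
    by apply: Gsigma => //; exists u => _ [i _ <-].
  have xy i : x i <= y by apply: yub; exists i.
  have y0u : 0 <= y <= u.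
    apply/andP; split; first by apply: le_trans (xy 0%N); have /andP[] := x0u 0%N.
    by apply: ylub => _ [i _ <-].
  exists y; split => //.
  have ysup g : (forall n, x n <= g) -> y <= g.
    by move=> Hg; apply: ylub => _ [i _ <-].
  have gs := generically_value_sup (bx _ y0u) (fun i => bx _ (x0u i)) xinc xy ysup.
  apply: generically_impl (generically_and gs (generically_all rx)) _.
  move=> w cw [ws wx].
  have mA i : measurable (A i : set (T * T)) by exact: borel2_measurable.
  have mU : measurable (\bigcup_i A i : set (T * T)) by exact: bigcup_measurable.
  apply/eqP; rewrite eq_le; apply/andP; split.
    have /cvg_lim <- // := nondecreasing_cvg_mu mA mU Ainc (mu := mu w).
    apply: lime_le; first by apply/cvg_ex; eexists; exact: nondecreasing_cvg_mu.
    apply: nearW => i /=; rewrite wx lee_fin.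
    by apply: chain_value_mono => //; exact: bx.
  apply/lee_addgt0Pr => e /ws[i Hi].
  apply: (@le_trans _ _ (mu w (A i) + e%:E)%E).
    by rewrite wx -EFinD lee_fin -lerBlDr.
  by apply: leeD2r; apply: le_measure; rewrite ?inE //; exact: bigcup_sup.
have repT : rep setT u.
  apply: generically_impl gen_mu _ => w cw [-> _].
  by rewrite (chain_value_unit R Gpo Gdir Gsigma Gint u0).
have all_rep A : borel2 A -> borel2 A /\ exists x, 0 <= x <= u /\ rep A x.
  move=> /borel2_rational; pose H := [set A : set (R * R) | borel2 A /\
    exists x, 0 <= x <= u /\ rep A x].
  suff : <<s @rational_quadrants R >> `<=` H by apply.
  apply: (lambda_system_subset (@rational_quadrants_setI R)) => //.
  - split => //.
    + by split; [exact: borel2T|exists u; rewrite u0 lexx].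
    + move=> {}A B BA [bA [x [x0u rx]]] [bB [y [y0u ry]]]; split; first exact: borel2D.
      exists (x - y); split; last by apply: repD => //; exact: bx.
      have yx := rep_le B A y x bB bA BA ry rx (bx _ y0u) (bx _ x0u).
      move/andP: x0u => [x0 xu]; move/andP: y0u => [y0 yu].
      apply/andP; split; first by apply: (le_sub_eq Gpo yx); abel.
      by apply: (le_sub_eq Gpo (poD Gpo xu y0)); abel.
    + move=> {}A Ainc HA; split; first by apply: borel2_bigcup => i; have [] := HA i.
      have /choice[x Hx] i : exists x, 0 <= x <= u /\ rep (A i) x.
        by have [] := HA i.
      have [|//|i|i|y [y0u ry _]] := rep_sup A x.
      * by move=> i; have [] := HA i.
      * by have [] := Hx i.
      * by have [] := Hx i.
      * by exists y.
  - move=> _ [q [r ->]]; split; first exact: borel2_quadrant.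
    exists (Phi (ratr q) (ratr r)); rewrite Phi_ge0 Phi_le; split => //.
    by apply: generically_impl gen_mu _ => w _ [_].
have /choice[m Hm] : forall A, exists x, borel2 A -> 0 <= x <= u /\ rep A x.
  move=> A; have [bA|nA] := pselect (borel2 A); last by exists 0.
  by have [_ [x Hx]] := all_rep A bA; exists x.
have bm A : borel2 A -> bounded (m A) by move=> /Hm[/bx].
have m0u A : borel2 A -> 0 <= m A <= u by move=> /Hm[].
have rm A : borel2 A -> rep A (m A) by move=> /Hm[].
have msup (A : nat -> set (R * R)) : (forall i, borel2 (A i)) ->
    nondecreasing_seq A ->
    supremums (range (fun i => m (A i))) (m (\bigcup_i A i)).
  move=> bA Ainc; have [||y [y0u ry ys]] := rep_sup A (m \o A) bA Ainc.
  - by move=> i; exact: m0u.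
  - by move=> i; exact: rm.
  - suff -> : m (\bigcup_i A i) = y by [].
    have bU := borel2_bigcup bA.
    by apply: (rep_inj _ _ _ bU) => //; [exact: rm|exact: bm|exact: bx].
have mle A B : borel2 A -> borel2 B -> A `<=` B -> m A <= m B.
  move=> bA bB AB.
  by apply: (rep_le A B) => //; [exact: rm|exact: rm|exact: bm|exact: bm].
have mQ (q r : rat) : m (quadrant (ratr q) (ratr r)) = Phi (ratr q) (ratr r).
  have bQ := @borel2_quadrant R (ratr q) (ratr r).
  apply: (rep_inj _ _ _ bQ) => //; [exact: rm| |exact: bm].
  by apply: generically_impl gen_mu _ => w _ [_].
exists m; split => //.
- have bT := @borel2T R.
  by apply: (rep_inj setT) => //; [exact: rm|exact: bm].
- by move=> A /m0u/andP[].
- move=> A B bA bB AB0.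
  have bU := borel2U bA bB.
  (* Representation is known to pass to proper differences, so additivity is read off from a
     difference. *)
  have AE : A = (A `|` B) `\` B.
    rewrite setDUl setDv setU0; apply/esym/setDidPl/seteqP; split => //.
    by rewrite AB0.
  have rA := repD _ _ _ _ bU bB (@subsetUr _ A B) (rm _ bU) (rm _ bB) (bm _ bU) (bm _ bB).
  rewrite -AE in rA; suff -> : m A = m (A `|` B) - m B by rewrite subrK.
  by apply: (rep_inj A) => //; [exact: rm|exact: bm|apply: po_boundedB => //; exact: bm].
(* Only rational quadrants are represented by construction. For real s and t, both sides are suprema
   along the points s - 1/(n+1), t - 1/(n+1), and are compared through rational points in
   between. *)
- move=> s t; apply/eqP; rewrite eq_le; apply/andP; split; last first.
    apply: Phi_left => n.
    have [q qs] := @rat_in_itvoo R (s - n.+1%:R^-1) s ltac:(by rewrite gtrBl invr_gt0 ltr0n).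
    have [r rt] := @rat_in_itvoo R (t - n.+1%:R^-1) t ltac:(by rewrite gtrBl invr_gt0 ltr0n).
    move: qs; rewrite in_itv /= => /andP[q1 q2].
    move: rt; rewrite in_itv /= => /andP[r1 r2].
    apply: (@le_trans _ _ (Phi (ratr q) (ratr r))); first by apply: Phi_mono; exact: ltW.
    rewrite -mQ; apply: mle; try exact: borel2_quadrant.
    move=> [x y]; rewrite /quadrant /= !in_itv /= => -[xq yr].
    by split; [exact: lt_trans q2|exact: lt_trans r2].
  pose A n := quadrant (s - n.+1%:R^-1) (t - n.+1%:R^-1) : set (R * R).
  have Vn_le i j : (i <= j)%N -> j.+1%:R^-1 <= i.+1%:R^-1 :> R.
    by move=> ij; rewrite lef_pV2 ?posrE ?ltr0n // ler_nat.
  have AU : quadrant s t = \bigcup_n A n.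
    apply/seteqP; split => [[x y]|[x y] [n _]]; rewrite /A /quadrant /= !in_itv /=.
      move=> [xs yt]; have e0 : 0 < Num.min (s - x) (t - y) by rewrite lt_min !subr_gt0 xs.
      have [n] := ltr_add_invr e0; rewrite add0r lt_min => /andP[n1 n2].
      exists n => //=; rewrite !in_itv /=; split.
        by rewrite ltrBrDl -ltrBrDr.
      by rewrite ltrBrDl -ltrBrDr.
    move=> [xs yt]; split; first by apply: lt_trans xs _; rewrite gtrBl invr_gt0 ltr0n.
    by apply: lt_trans yt _; rewrite gtrBl invr_gt0 ltr0n.
  have [_ lub] : supremums (range (fun i => m (A i))) (m (\bigcup_i A i)).
    apply: msup => [i|i j ij]; first exact: borel2_quadrant.
    apply/subsetPset => -[x y]; rewrite /A /quadrant /= !in_itv /= => -[xi yi].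
    split; [apply: lt_le_trans xi _|apply: lt_le_trans yi _];
      by rewrite lerD2l lerN2 Vn_le.
  rewrite AU; apply: lub => _ [n _ <-].
  have [q qs] := @rat_in_itvoo R (s - n.+1%:R^-1) s ltac:(by rewrite gtrBl invr_gt0 ltr0n).
  have [r rt] := @rat_in_itvoo R (t - n.+1%:R^-1) t ltac:(by rewrite gtrBl invr_gt0 ltr0n).
  move: qs; rewrite in_itv /= => /andP[q1 q2].
  move: rt; rewrite in_itv /= => /andP[r1 r2].
  apply: (@le_trans _ _ (Phi (ratr q) (ratr r))); last by apply: Phi_mono; exact: ltW.
  rewrite -mQ; apply: mle; try exact: borel2_quadrant.
  move=> [x y]; rewrite /A /quadrant /= !in_itv /= => -[xq yr].
  by split; [exact: lt_trans q1|exact: lt_trans r1].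
Qed.

End VectorMeasure.

(** * Perfect effect algebras *)

Section PerfectElements.
Context (G : porderZmodType) (Gpo : po_group G) (Gdir : directed G)
  (Gsigma : monotone_sigma_complete G).
Implicit Types (a b c : perfect_ea G) (g : G).

Definition zpart a : int := (\val a : int * G).1.
Definition gpart a : G := (\val a : int * G).2.

Lemma val_perfect a : \val a = (zpart a, gpart a) :> Zlex G.
Proof. by rewrite /zpart /gpart; case: (\val a). Qed.

Lemma le_perfect a b :
  (a <= b) = (zpart a < zpart b) || ((zpart a == zpart b) && (gpart a <= gpart b)).
Proof. by rewrite leEsub !val_perfect le_ZlexE. Qed.

Lemma perfect_cases a :
  (zpart a = 0 /\ 0 <= gpart a) \/ (zpart a = 1 /\ gpart a <= 0).
Proof.
have /andP[] : 0 <= \val a <= Zlex_unit by case: a.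
rewrite val_perfect -[0]/((0, 0) : Zlex G) !le_ZlexE.
move=> /orP[a0|/andP[/eqP <- ga]]; last by left.
move=> /orP[a1|/andP[/eqP -> ga]]; last by right.
by case: (zpart a) a0 a1 => [[|[]]|].
Qed.

Lemma perfect_ex0 g : 0 <= g -> exists a, zpart a = 0 /\ gpart a = g.
Proof.
move=> g0; have H : 0 <= ((0, g) : Zlex G) <= Zlex_unit.
  by rewrite -[X in X <= _ <= _]/((0, 0) : Zlex G) !le_ZlexE eqxx g0.
by exists (GammaEa H).
Qed.

Lemma perfect_ex1 g : g <= 0 -> exists a, zpart a = 1 /\ gpart a = g.
Proof.
move=> g0; have H : 0 <= ((1, g) : Zlex G) <= Zlex_unit.
  by rewrite -[X in X <= _ <= _]/((0, 0) : Zlex G) !le_ZlexE eqxx g0.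
by exists (GammaEa H).
Qed.

Lemma perfect_eq a b : zpart a = zpart b -> gpart a = gpart b -> a = b.
Proof. by move=> ez eg; apply: val_inj; rewrite !val_perfect ez eg. Qed.

Lemma Rad_complE a : Rad_compl a <-> zpart a = 1.
Proof.
split=> [[g g0 E]|a1]; first by rewrite /zpart E.
have [[a0 _]|[_ ga]] := perfect_cases a; first by rewrite a0 in a1.
exists (- gpart a); last by rewrite opprK val_perfect a1.
by apply: (le_sub_eq Gpo ga); abel.
Qed.

Lemma zpart_mono a b : a <= b -> zpart a <= zpart b.
Proof. by rewrite le_perfect => /orP[/ltW//|/andP[/eqP->]]. Qed.

Lemma gpart_mono a b : zpart a = zpart b -> a <= b -> gpart a <= gpart b.
Proof. by move=> E; rewrite le_perfect E ltxx eqxx. Qed.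

(* All the (1, - e) with e >= 0 are upper bounds of the radical: were one of them
   the least upper bound of a set of radical elements, G would be zero. *)
Lemma zpart_supremum (A : set (perfect_ea G)) a : supremums A a ->
  (forall b, A b -> zpart b = 0) -> zpart a = 0.
Proof.
move=> [aub alub] A0; apply: contrapT => za.
have [[//]|[a1 ga]] := perfect_cases a.
have low g : g <= 0 -> gpart a <= g.
  move=> g0; have [b [b1 bg]] := perfect_ex1 g0.
  have /gpart_mono : a <= b.
    by apply: alub => c /A0 c0; rewrite le_perfect c0 b1.
  by rewrite a1 b1 bg; apply.
have ga0 : 0 <= gpart a.
  have : gpart a <= gpart a *+ 2.
    by apply: low; have := poMn Gpo 2 ga; rewrite mul0rn.
  by move/(le_sub_eq Gpo); apply; abel.
have : a <= ea0.
  apply: alub => c Ac; have c0 := A0 _ Ac.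
  rewrite le_perfect c0 /= -[gpart ea0]/(0 : G).
  have [[_ gc]|[c1]] := perfect_cases c; last by rewrite c1 in c0.
  have : gpart a <= - gpart c by apply: low; apply: (le_sub_eq Gpo gc); abel.
  by move=> /(le_trans ga0)/(le_sub_eq Gpo); apply; abel.
by move=> /zpart_mono; rewrite a1.
Qed.

(** Otherwise all (0, g) with g >= 0 would be lower bounds of A, hence equal to 0; with a trivial
    positive cone, the top 1 would itself be a lower bound. *)
Lemma zpart_infimum0 (A : set (perfect_ea G)) : infimums A ea0 ->
  exists2 b, A b & zpart b = 0.
Proof.
move=> [_ lub]; apply: contrapT => H.
have A1 b : A b -> zpart b = 1.
  move=> Ab; have [[b0 _]|[]//] := perfect_cases b.
  by exfalso; apply: H; exists b.
have pos0 g : 0 <= g -> g <= 0.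
  move=> g0; have [b [b0 bg]] := perfect_ex0 g0.
  have /gpart_mono : b <= ea0.
    by apply: lub => c /A1 c1; rewrite le_perfect c1 b0.
  by rewrite b0 bg; apply.
have : ea1 <= ea0 :> perfect_ea G.
  apply: lub => c Ac; have c1 := A1 _ Ac.
  rewrite le_perfect c1 /= -[gpart ea1]/(0 : G).
  have [[c0 _]|[_ gc]] := perfect_cases c; first by rewrite c0 in c1.
  have : - gpart c <= 0 by apply: pos0; apply: (le_sub_eq Gpo gc); abel.
  by move/(le_sub_eq Gpo); apply; abel.
by move=> /zpart_mono.
Qed.

(** Suprema in E and in G agree while the integer part is constant: the supremum y of the G-parts
    exists, and the element with that integer part and G-part y lies in E again. *)
Lemma gpart_supremum (x : nat -> perfect_ea G) a g : nondecreasing_seq x ->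
  (forall n, zpart (x n) = zpart a) -> (forall n, x n <= a) ->
  (forall b, (forall n, x n <= b) -> a <= b) ->
  (forall n, gpart (x n) <= g) -> gpart a <= g.
Proof.
move=> xd xz xa alub xg.
have gxa n : gpart (x n) <= gpart a by apply: gpart_mono.
have [] := @Gsigma (fun n => gpart (x n)).
- by move=> i j ij; apply: gpart_mono; [rewrite !xz|exact: xd].
- by exists (gpart a) => _ [n _ <-].
move=> y [yub ylub].
have xy n : gpart (x n) <= y by apply: yub; exists n.
have ya : y <= gpart a by apply: ylub => _ [n _ <-].
have [b [bz bg]] : exists b, zpart b = zpart a /\ gpart b = y.
  have [[a0 _]|[a1 ga]] := perfect_cases a.
    have [[_ g0]|[x1 _]] := perfect_cases (x 0%N).
      by rewrite a0; apply: perfect_ex0; exact: le_trans (xy 0%N).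
    by rewrite xz a0 in x1.
  by rewrite a1; apply: perfect_ex1; exact: le_trans ga.
have : a <= b by apply: alub => n; rewrite le_perfect xz bz eqxx bg xy orbT.
move=> /gpart_mono; rewrite bz bg => /(_ erefl)/le_trans; apply.
by apply: ylub => _ [n _ <-].
Qed.

Lemma gpart_infimum0 (x : nat -> perfect_ea G) g : nonincreasing_seq x ->
  (forall n, zpart (x n) = 0) ->
  (forall b, (forall n, b <= x n) -> b <= ea0) ->
  (forall n, g <= gpart (x n)) -> g <= 0.
Proof.
move=> xd xz xlub xg.
have gx0 n : 0 <= gpart (x n).
  by have [[]//|[x1]] := perfect_cases (x n); rewrite xz in x1.
have [] := @Gsigma (fun n => - gpart (x n)).
- move=> i j ij; have : gpart (x j) <= gpart (x i).
    by apply: gpart_mono; [rewrite !xz|exact: xd].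
  by move/(le_sub_eq Gpo); apply; abel.
- by exists 0 => _ [n _ <-]; apply: (le_sub_eq Gpo (gx0 n)); abel.
move=> y [yub ylub].
have y0 : y <= 0.
  by apply: ylub => _ [n _ <-]; apply: (le_sub_eq Gpo (gx0 n)); abel.
have [b [bz bg]] : exists b, zpart b = 0 /\ gpart b = - y.
  by apply: perfect_ex0; apply: (le_sub_eq Gpo y0); abel.
have : b <= ea0.
  apply: xlub => n; rewrite le_perfect xz bz bg /=.
  have : - gpart (x n) <= y by apply: yub; exists n.
  by move/(le_sub_eq Gpo); apply; abel.
move=> /gpart_mono; rewrite bz bg -[gpart ea0]/(0 : G) => /(_ erefl).
have : y <= - g.
  by apply: ylub => _ [n _ <-]; apply: (le_sub_eq Gpo (xg n)); abel.
by move=> H /(poD Gpo H)/(le_sub_eq Gpo); apply; abel.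
Qed.

Lemma ea_add_val a b c : ea_add a b = Some c -> \val c = \val a + \val b.
Proof. by rewrite /ea_add; case: insubP => // d _ <- [<-]. Qed.

End PerfectElements.

(** * From a spectral resolution to an observable *)

Section Resolution.
Context (R : realType) (G : porderZmodType) (Gpo : po_group G)
  (Gdir : directed G) (Gsigma : monotone_sigma_complete G).
Context (F : R * R -> perfect_ea G) (Fres : spectral_resolution2 F).

Let z (s t : R) : int := zpart (F (s, t)).
Let g (s t : R) : G := gpart (F (s, t)).

Let F_volume : volume_condition F. Proof. by case: Fres. Qed.

Let F_left t1 t2 : supremums
  [set F p | p in [set p | p.1 < t1 /\ p.2 < t2]] (F (t1, t2)).
Proof. by case: Fres => _ H _ _ _; exact: H. Qed.

Lemma resolution_mono s s' t t' : s <= s' -> t <= t' -> F (s, t) <= F (s', t').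
Proof.
move=> ss' tt'; have [ub' _] := F_left s' t'; have [_ lub] := F_left s t.
apply: lub => _ [[a b] [/= a1 b1] <-]; apply: ub'; exists (a, b) => //=.
by split; [exact: lt_le_trans ss'|exact: lt_le_trans tt'].
Qed.

Let z01 s t : z s t = 0 \/ z s t = 1.
Proof. by rewrite /z; case: (perfect_cases (F (s, t))) => -[]; [left|right]. Qed.

Let z_mono s s' t t' : s <= s' -> t <= t' -> z s t <= z s' t'.
Proof. by move=> ss' tt'; apply: zpart_mono; exact: resolution_mono. Qed.

Let z_up s s' t t' : s <= s' -> t <= t' -> z s t = 1 -> z s' t' = 1.
Proof.
by move=> ss' tt' E; have := z_mono ss' tt'; case: (z01 s' t') => // ->; rewrite E.
Qed.

Let zvol s s' t t' := z s' t' - z s t' - z s' t + z s t.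
Let gvol s s' t t' := g s' t' - g s t' - g s' t + g s t.

Let volumeE s s' t t' : s <= s' -> t <= t' ->
  0 < zvol s s' t t' \/ (zvol s s' t t' = 0 /\ 0 <= gvol s s' t t').
Proof.
move=> ss' tt'; have := F_volume ss' tt'.
rewrite !val_perfect -[X in X <= _]/((0, 0) : Zlex G).
rewrite -[X in _ <= X]/((zvol s s' t t', gvol s s' t t') : Zlex G) le_ZlexE.
by move=> /orP[->|/andP[/eqP <- ->]]; [left|right].
Qed.

(** If the minimum had integer part 0, the rectangle spanned by the two points would have a volume
    with integer part -1. *)
Let z_min s s' t t' : z s t = 1 -> z s' t' = 1 ->
  z (Order.min s s') (Order.min t t') = 1.
Proof.
have aux a a' b b' : a <= a' -> b <= b' -> z a b' = 1 -> z a' b = 1 -> z a b = 1.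
  move=> aa' bb' E1 E2; have E3 := z_up aa' (lexx b') E1.
  have := volumeE aa' bb'; rewrite /zvol E1 E2 E3.
  by case: (z01 a b) => -> // -[|[]].
have [ss'|/ltW s's] := leP s s'; have [tt'|/ltW t't] := leP t t' => // E E'.
  by apply: (aux s s' t' t).
by apply: (aux s' s t t').
Qed.

Let z_ex1 : exists p : R * R, z p.1 p.2 = 1.
Proof.
apply: contrapT => H; have [_ _ _ F1 _] := Fres.
have : zpart (@ea1 G) = 0.
  apply: (zpart_supremum Gpo F1) => _ [[s t] _ <-].
  by case: (z01 s t) => // E; exfalso; apply: H; exists (s, t).
by [].
Qed.

Let z_ex0l t : exists s, z s t = 0.
Proof.
have [_ _ /(_ t)[H1 _] _ _] := Fres.
by have [_ [s _ <-] zs] := zpart_infimum0 Gpo H1; exists s.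
Qed.

Let z_ex0r s : exists t, z s t = 0.
Proof.
have [_ _ /(_ s)[_ H2] _ _] := Fres.
by have [_ [t _ <-] zt] := zpart_infimum0 Gpo H2; exists t.
Qed.

Let s0 := (characteristic_point F).1.
Let t0 := (characteristic_point F).2.

(** The set where z is 1 is closed upward and under coordinatewise minima, hence a quadrant; clause
    (iii) bounds it from below, and left continuity makes the inequalities strict. *)
Let z1P s t : z s t = 1 <-> s0 < s /\ t0 < t.
Proof.
have [[a b] /= zab] := z_ex1.
have memT p : (F @^-1` Rad_compl) p <-> z p.1 p.2 = 1.
  by case: p => x y /=; exact: Rad_complE.
have infs : has_inf [set p.1 | p in F @^-1` Rad_compl].
  split; first by exists a, (a, b) => //; apply/memT.
  have [s1 zs1] := z_ex0l b; exists s1 => _ [[x y] /memT /= zxy <-].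
  rewrite leNgt; apply/negP => xs1.
  have := z_min zab zxy => /(@z_up _ s1 _ b); rewrite ge_min ge_min lexx.
  by rewrite (ltW xs1) orbT zs1 => /(_ isT isT).
have inft : has_inf [set p.2 | p in F @^-1` Rad_compl].
  split; first by exists b, (a, b) => //; apply/memT.
  have [t1 zt1] := z_ex0r a; exists t1 => _ [[x y] /memT /= zxy <-].
  rewrite leNgt; apply/negP => yt1.
  have := z_min zab zxy => /(@z_up _ a _ t1); rewrite ge_min ge_min lexx.
  by rewrite (ltW yt1) orbT zt1 => /(_ isT isT).
split=> [zst|[s0s t0t]].
  have [p [[p1 p2] zp]] : exists p : R * R, (p.1 < s /\ p.2 < t) /\ z p.1 p.2 = 1.
    apply: contrapT => H; have := F_left s t => /(zpart_supremum Gpo) H'.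
    have : z s t = 0.
      apply: H' => _ [[x y] xy <-].
      by case: (z01 x y) => // E; exfalso; apply: H; exists (x, y).
    by rewrite zst.
  split; [apply: le_lt_trans p1|apply: le_lt_trans p2].
    by apply: (ge_inf infs.2); exists p => //; apply/memT.
  by apply: (ge_inf inft.2); exists p => //; apply/memT.
have [_ [p /memT zp <-] ps] := inf_lt infs.1 s0s.
have [_ [q /memT zq <-] qt] := inf_lt inft.1 t0t.
apply: z_up (z_min zp zq); rewrite ge_min; first by rewrite ltW.
by rewrite (ltW qt) orbT.
Qed.

Let z0P s t : ~ (s0 < s /\ t0 < t) -> z s t = 0.
Proof. by case: (z01 s t) => // E H; exfalso; apply/H/z1P. Qed.

Lemma resolution_zpart s t : zpart (F (s, t)) = ((s0 < s) && (t0 < t))%R%:Z.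
Proof. by case: andP => H; [exact/z1P|exact: z0P]. Qed.

Let zvolE s s' t t' :
  zvol s s' t t' = ((s0 < s')%R%:Z - (s0 < s)%R%:Z) * ((t0 < t')%R%:Z - (t0 < t)%R%:Z).
Proof.
rewrite /zvol /z !resolution_zpart.
by case: (s0 < s'); case: (s0 < s); case: (t0 < t'); case: (t0 < t).
Qed.

Let gvol_ge0 s s' t t' : s <= s' -> t <= t' -> zvol s s' t t' = 0 ->
  0 <= gvol s s' t t'.
Proof. by move=> ss' tt' E; have := volumeE ss' tt'; rewrite E => -[|[]]. Qed.

Let g_mono s s' t t' : s <= s' -> t <= t' -> z s t = z s' t' -> g s t <= g s' t'.
Proof. by move=> ss' tt' E; apply: gpart_mono => //; exact: resolution_mono. Qed.

Let g_ge0 s t : ~ (s0 < s /\ t0 < t) -> 0 <= g s t.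
Proof.
by move=> /z0P zst; have [[]//|[z1]] := perfect_cases (F (s, t)); rewrite -/(z s t) zst in z1.
Qed.

Let g_le0 s t : s0 < s -> t0 < t -> g s t <= 0.
Proof.
move=> s0s t0t; have zst : z s t = 1 by apply/z1P.
by have [[z1]|[]//] := perfect_cases (F (s, t)); rewrite -/(z s t) zst in z1.
Qed.

(* The G-part of the volumes of squares shrinking to the characteristic point; its
   infimum is the G-part of the value of the observable at that point. *)
Let corner (n : nat) := gvol s0 (s0 + n.+1%:R^-1) t0 (t0 + n.+1%:R^-1).

Let v_mono (i j : nat) : (i <= j)%N -> j.+1%:R^-1 <= i.+1%:R^-1 :> R.
Proof. by move=> ij; rewrite lef_pV2 ?posrE ?ltr0n // ler_nat. Qed.

Let gvol_splitl s s' s'' t t' : gvol s s'' t t' = gvol s s' t t' + gvol s' s'' t t'.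
Proof. by rewrite /gvol; abel. Qed.

Let gvol_splitr s s' t t' t'' : gvol s s' t t'' = gvol s s' t t' + gvol s s' t' t''.
Proof. by rewrite /gvol; abel. Qed.

(** The difference of the two rectangles is cut into four that miss the characteristic point; their
    volumes have integer part 0, so their G-parts are nonnegative. *)
Let gvol_sub s s' v t t' v' : s <= s0 -> s0 < v -> v <= s' -> t <= t0 -> t0 < v' ->
  v' <= t' -> gvol s0 v t0 v' <= gvol s s' t t'.
Proof.
move=> ss0 s0v vs' tt0 t0v v't'.
rewrite (gvol_splitl s s0 s') (gvol_splitl s0 v s').
rewrite (gvol_splitr s0 v t t0 t') (gvol_splitr s0 v t0 v' t').
have tt' : t <= t' := le_trans tt0 (le_trans (ltW t0v) v't').
have H1 : 0 <= gvol s s0 t t'.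
  by apply: gvol_ge0 => //; rewrite zvolE ltxx [s0 < s]ltNge ss0 mul0r.
have H2 : 0 <= gvol v s' t t'.
  by apply: gvol_ge0 => //; rewrite zvolE s0v (lt_le_trans s0v vs') subrr mul0r.
have H3 : 0 <= gvol s0 v t t0.
  apply: gvol_ge0 => //; first exact: ltW.
  by rewrite zvolE !ltxx [t0 < t]ltNge tt0 mulr0.
have H4 : 0 <= gvol s0 v v' t'.
  apply: gvol_ge0 => //; first exact: ltW.
  by rewrite zvolE t0v (lt_le_trans t0v v't') subrr mulr0.
by apply: (le_sub_eq Gpo (poD Gpo (poD Gpo H1 H2) (poD Gpo H3 H4))); abel.
Qed.

(** The infimum a of clause (v) has integer part 1, so its G-part bounds g from below at the upper
    right corners. The two subtracted corners are at most their values at distance 1, and g at the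
    characteristic point is nonnegative. *)
Let corner_inf : exists gamma,
  (forall n, gamma <= corner n) /\ (forall y, (forall n, y <= corner n) -> y <= gamma).
Proof.
have [] := @Gsigma (fun n => - corner n).
- move=> i j ij; have : corner j <= corner i.
    apply: gvol_sub; rewrite ?lexx ?ltrDl //; by rewrite lerD2l v_mono.
  by move/(le_sub_eq Gpo); apply; abel.
- have [_ _ _ _] := Fres => -[a [alb _] /(Rad_complE Gpo) za].
  exists (- (gpart a - g s0 (t0 + 1) - g (s0 + 1) t0)) => _ [n _ <-].
  have v1 : n.+1%:R^-1 <= 1 :> R by rewrite invf_le1 ?ltr0n // ler1n.
  have H1 : gpart a <= g (s0 + n.+1%:R^-1) (t0 + n.+1%:R^-1).
    apply: gpart_mono.
      by rewrite za; apply/esym/z1P; rewrite !ltrDl.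
    by apply: alb; exists (s0 + n.+1%:R^-1, t0 + n.+1%:R^-1) => //=; rewrite !ltrDl.
  have H2 : g s0 (t0 + n.+1%:R^-1) <= g s0 (t0 + 1).
    apply: g_mono; rewrite ?lerD2l // !z0P // ltxx => -[] //.
  have H3 : g (s0 + n.+1%:R^-1) t0 <= g (s0 + 1) t0.
    apply: g_mono; rewrite ?lerD2l // !z0P // ltxx => -[] //.
  have H4 : 0 <= g s0 t0 by apply: g_ge0; rewrite ltxx => -[].
  rewrite /corner /gvol.
  by apply: (le_sub_eq Gpo (poD Gpo (poD Gpo H1 H2) (poD Gpo H3 H4))); abel.
move=> y [yub ylub]; exists (- y); split=> [n|w wd].
  have : - corner n <= y by apply: yub; exists n.
  by move/(le_sub_eq Gpo); apply; abel.
have : y <= - w.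
  by apply: ylub => _ [n _ <-]; apply: (le_sub_eq Gpo (wd n)); abel.
by move/(le_sub_eq Gpo); apply; abel.
Qed.


Let F_seq_left s t b :
  (forall n, F (s - n.+1%:R^-1, t - n.+1%:R^-1) <= b) -> F (s, t) <= b.
Proof.
move=> Hb; have [_ lub] := F_left s t; apply: lub => _ [[x y] [/= xs yt] <-].
have e0 : 0 < Num.min (s - x) (t - y) by rewrite lt_min !subr_gt0 xs.
have [n] := ltr_add_invr e0; rewrite add0r lt_min => /andP[n1 n2].
apply: le_trans (Hb n); apply: resolution_mono.
  by rewrite lerBrDl -lerBrDr ltW.
by rewrite lerBrDl -lerBrDr ltW.
Qed.

Lemma resolution_observable (Gint : interpolation G) :
  exists x, observable2 x /\ extends2 x F.
Proof.
have [gamma [gamma_le gamma_glb]] := corner_inf.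
pose Phi s t : G := g s t - gamma *+ ((s0 < s) && (t0 < t)).
have PhiT s t : s0 < s -> t0 < t -> Phi s t = g s t - gamma.
  by move=> s0s t0t; rewrite /Phi s0s t0t.
have PhiF s t : ~ (s0 < s /\ t0 < t) -> Phi s t = g s t.
  by move=> /andP/negbTE; rewrite /Phi => ->; rewrite mulr0n subr0.
have small s t : s0 < s -> t0 < t ->
    exists n : nat, s0 + n.+1%:R^-1 <= s /\ t0 + n.+1%:R^-1 <= t.
  move=> s0s t0t; have e0 : 0 < Num.min (s - s0) (t - t0) by rewrite lt_min !subr_gt0 s0s.
  have [n] := ltr_add_invr e0; rewrite add0r lt_min => /andP[n1 n2].
  by exists n; rewrite -!lerBrDl !ltW.
have around s s' t t' : s <= s0 -> s0 < s' -> t <= t0 -> t0 < t' ->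
    gamma <= gvol s s' t t'.
  move=> ss0 s0s' tt0 t0t'; have [n [n1 n2]] := small _ _ s0s' t0t'.
  by apply: le_trans (gamma_le n) _; apply: gvol_sub; rewrite ?ltrDl.
have Phi_volume s s' t t' : s <= s' -> t <= t' ->
    0 <= Phi s' t' - Phi s t' - Phi s' t + Phi s t.
  move=> ss' tt'.
  have [[[ss0 s0s'] [tt0 t0t']]|H] :=
      pselect ((s <= s0 /\ s0 < s') /\ (t <= t0 /\ t0 < t')).
    rewrite PhiT // !PhiF; try by rewrite !ltNge ?ss0 ?tt0 => -[].
    by apply: (le_sub_eq Gpo (around _ _ _ _ ss0 s0s' tt0 t0t')); rewrite /gvol; abel.
  (* The rectangle misses the characteristic point, so the multiples of [gamma] cancel and the
     volume is that of g. *)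
  have zv : zvol s s' t t' = 0.
    rewrite zvolE; case: (leP s s0) H => ss0; last first.
      by rewrite (lt_le_trans ss0 ss') subrr mul0r.
    case: (leP t t0) => tt0; last by rewrite (lt_le_trans tt0 tt') subrr mulr0.
    case: (ltP s0 s') => s0s'; last by rewrite mul0r.
    by case: (ltP t0 t') => t0t' H; [exfalso; exact: H|rewrite mulr0].
  apply: (le_sub_eq Gpo (gvol_ge0 ss' tt' zv)); rewrite /gvol /Phi.
  move: zv; rewrite /zvol /z !resolution_zpart.
  case: (_ && _); case: (_ && _); case: (_ && _); case: (_ && _) => // _;
    by rewrite ?mulr1n ?mulr0n; abel.
have Phi_ge0 s t : 0 <= Phi s t.
  have [[s0s t0t]|H] := pselect (s0 < s /\ t0 < t); last by rewrite PhiF // g_ge0.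
  rewrite PhiT //.
  have H := around s0 s t0 t (lexx _) s0s (lexx _) t0t.
  have H1 : g s0 t0 <= g s0 t.
    by apply: g_mono => //; [exact: ltW|rewrite !z0P // ltxx => -[]].
  have H2 : 0 <= g s t0 by apply: g_ge0; rewrite ltxx => -[].
  by apply: (le_sub_eq Gpo (poD Gpo H (poD Gpo H1 H2))); rewrite /gvol; abel.
have gammaN : gamma <= 0.
  have H := Phi_ge0 (s0 + 1) (t0 + 1); rewrite PhiT ?ltrDl // in H.
  have H' : g (s0 + 1) (t0 + 1) <= 0 by apply: g_le0; rewrite ltrDl.
  by apply: (le_sub_eq Gpo (poD Gpo H H')); abel.
have u0 : 0 <= - gamma by apply: (le_sub_eq Gpo gammaN); abel.
have Phi_mono s s' t t' : s <= s' -> t <= t' -> Phi s t <= Phi s' t'.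
  move=> ss' tt'.
  have [[s0s t0t]|nst] := pselect (s0 < s /\ t0 < t).
    have s0s' := lt_le_trans s0s ss'; have t0t' := lt_le_trans t0t tt'.
    rewrite !PhiT //; apply: (le_sub_eq Gpo (x := g s t) (y := g s' t')); last by abel.
    by apply: g_mono => //; apply/esym; rewrite (proj2 (z1P s t)) //; apply/z1P.
  rewrite [Phi s t]PhiF //.
  have [[s0s' t0t']|nst'] := pselect (s0 < s' /\ t0 < t'); last first.
    by rewrite PhiF //; apply: g_mono => //; rewrite !z0P.
  rewrite PhiT //.
  (* Here F passes from the radical to its complements, where monotonicity of F does not compare
     G-parts. A rectangle around the characteristic point, with the free lower corner moved to at
     most t0 or s0, gives the missing [gamma]. *)
  have [ss0|s0s] := leP s s0.
    pose b := Order.min t t0.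
    have bt0 : b <= t0 by rewrite ge_min lexx orbT.
    have H := around s s' b t' ss0 s0s' bt0 t0t'.
    have H1 : g s t <= g s t' by apply: g_mono => //; rewrite !z0P // ltNge ss0 => -[].
    have H2 : g s b <= g s' b.
      by apply: g_mono => //; rewrite !z0P // [t0 < b]ltNge bt0 => -[].
    by apply: (le_sub_eq Gpo (poD Gpo H (poD Gpo H1 H2))); rewrite /gvol; abel.
  have tt0 : t <= t0 by rewrite leNgt; apply/negP => t0t; exact: nst.
  pose a := Order.min s s0.
  have as0 : a <= s0 by rewrite ge_min lexx orbT.
  have H := around a s' t t' as0 s0s' tt0 t0t'.
  have H1 : g s t <= g s' t.
    by apply: g_mono => //; rewrite !z0P // [t0 < t]ltNge tt0 => -[].
  have H2 : g a t <= g a t' by apply: g_mono => //; rewrite !z0P // ltNge as0 => -[].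
  by apply: (le_sub_eq Gpo (poD Gpo H (poD Gpo H1 H2))); rewrite /gvol; abel.
have Phi_le s t : Phi s t <= - gamma.
  pose s1 := Num.max s (s0 + 1); pose t1 := Num.max t (t0 + 1).
  have s01 : s0 < s1 by rewrite lt_max ltrDl ltr01 orbT.
  have t01 : t0 < t1 by rewrite lt_max ltrDl ltr01 orbT.
  have H : Phi s t <= Phi s1 t1 by apply: Phi_mono; rewrite le_max lexx.
  apply: le_trans H _; rewrite PhiT //.
  by apply: (le_sub_eq Gpo (g_le0 s01 t01)); abel.
have Phi_left s t y : (forall n, Phi (s - n.+1%:R^-1) (t - n.+1%:R^-1) <= y) ->
    Phi s t <= y.
  (* The shift N drops the terms whose integer part differs from that of F (s, t), as
     [gpart_supremum] requires. *)
  move=> Hy; pose x N n := F (s - (n + N).+1%:R^-1, t - (n + N).+1%:R^-1).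
  have xd N : nondecreasing_seq (x N).
    move=> i j ij; apply: resolution_mono; rewrite lerD2l lerN2 v_mono //;
      by rewrite leq_add2r.
  have xle N n : x N n <= F (s, t) by apply: resolution_mono; rewrite gerBl ltW.
  have xlub N b : (forall n, x N n <= b) -> F (s, t) <= b.
    move=> Hb; apply: F_seq_left => n; apply: le_trans (Hb n).
    by apply: resolution_mono; rewrite lerD2l lerN2 v_mono // leq_addr.
  have [[s0s t0t]|nst] := pselect (s0 < s /\ t0 < t); last first.
    have n0 n : ~ (s0 < s - n.+1%:R^-1 /\ t0 < t - n.+1%:R^-1).
      by move=> [H1 H2]; apply: nst; split; [apply: lt_trans H1 _|apply: lt_trans H2 _];
        rewrite gtrBl.
    rewrite PhiF //; apply: (gpart_supremum Gsigma (xd 0%N) _ (xle 0%N) (xlub 0%N)).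
      by move=> n; rewrite -/(z _ _) -/(z s t) !z0P.
    by move=> n; have := Hy (n + 0)%N; rewrite PhiF.
  have [N [N1 N2]] := small _ _ s0s t0t.
  have big n : s0 < s - (n + N.+1).+1%:R^-1 /\ t0 < t - (n + N.+1).+1%:R^-1.
    have vN : (n + N.+1).+1%:R^-1 < N.+1%:R^-1 :> R.
      by rewrite ltf_pV2 ?posrE ?ltr0n // ltr_nat !ltnS addnS ltnS leq_addl.
    by rewrite !ltrBrDr; split; [apply: lt_le_trans N1|apply: lt_le_trans N2];
      rewrite ltrD2l.
  rewrite PhiT //; suff H : g s t <= y + gamma by apply: (le_sub_eq Gpo H); abel.
  apply: (gpart_supremum Gsigma (xd N.+1) _ (xle N.+1) (xlub N.+1)).
    by move=> n; rewrite -/(z _ _) -/(z s t) !(proj2 (z1P _ _)).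
  move=> n; have [b1 b2] := big n; have := Hy (n + N.+1)%N.
  by rewrite PhiT // => H; apply: (le_sub_eq Gpo H); rewrite /g; abel.
have nat_above (r : R) : exists N : nat, r < N%:R.
  exists (Num.truncn `|r|).+1; apply: le_lt_trans (ler_norm r) _.
  by have /andP[] := Num.Theory.truncn_itv (normr_ge0 r).
have Phi_Ny t y : (forall n, y <= Phi (- n%:R) t) -> y <= 0.
  move=> Hy; have [N HN] := nat_above (- s0).
  have N0 n : ~ (s0 < - (n + N)%:R /\ t0 < t).
    move=> [+ _]; rewrite ltrNr ltNge => /negP; apply; apply: ltW.
    by apply: lt_le_trans HN _; rewrite ler_nat leq_addl.
  apply: (gpart_infimum0 Gpo Gsigma (x := fun n => F (- (n + N)%:R, t))).
  - by move=> i j ij; apply: resolution_mono; rewrite // lerN2 ler_nat leq_add2r.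
  - by move=> n; rewrite -/(z _ _) z0P.
  - move=> b Hb; have [_ _ /(_ t)[[_ glb] _] _ _] := Fres; apply: glb => _ [s _ <-].
    have [n Hn] := nat_above (- s); apply: le_trans (Hb n) _.
    apply: resolution_mono => //; rewrite lerNl; apply/ltW/(lt_le_trans Hn).
    by rewrite ler_nat leq_addr.
  - by move=> n; have := Hy (n + N)%N; rewrite PhiF.
have Phi_xN s y : (forall n, y <= Phi s (- n%:R)) -> y <= 0.
  move=> Hy; have [N HN] := nat_above (- t0).
  have N0 n : ~ (s0 < s /\ t0 < - (n + N)%:R).
    move=> [_]; rewrite ltrNr ltNge => /negP; apply; apply: ltW.
    by apply: lt_le_trans HN _; rewrite ler_nat leq_addl.
  apply: (gpart_infimum0 Gpo Gsigma (x := fun n => F (s, - (n + N)%:R))).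
  - by move=> i j ij; apply: resolution_mono; rewrite // lerN2 ler_nat leq_add2r.
  - by move=> n; rewrite -/(z _ _) z0P.
  - move=> b Hb; have [_ _ /(_ s)[_ [_ glb]] _ _] := Fres; apply: glb => _ [t _ <-].
    have [n Hn] := nat_above (- t); apply: le_trans (Hb n) _.
    apply: resolution_mono => //; rewrite lerNl; apply/ltW/(lt_le_trans Hn).
    by rewrite ler_nat leq_addr.
  - by move=> n; have := Hy (n + N)%N; rewrite PhiF.
have Phi_total y : (forall n, Phi n%:R n%:R <= y) -> - gamma <= y.
  move=> Hy; have [N] := nat_above (Num.max s0 t0); rewrite gt_max => /andP[Ns Nt].
  have big n : s0 < (n + N)%:R /\ t0 < (n + N)%:R.
    by split; [apply: lt_le_trans Ns _|apply: lt_le_trans Nt _]; rewrite ler_nat leq_addl.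
  have [_ _ _ [F1ub F1lub] _] := Fres.
  suff H : gpart (@ea1 G) <= y + gamma.
    by apply: (le_sub_eq Gpo H); rewrite -[gpart ea1]/(0 : G); abel.
  apply: (gpart_supremum Gsigma (x := fun n => F ((n + N)%:R, (n + N)%:R))).
  - by move=> i j ij; apply: resolution_mono; rewrite ler_nat leq_add2r.
  - by move=> n; rewrite -/(z _ _) (proj2 (z1P _ _)).
  - by move=> n; apply: F1ub; exists ((n + N)%:R, (n + N)%:R).
  - move=> b Hb; apply: F1lub => _ [[s t] _ <-].
    have [n] := nat_above (Num.max s t); rewrite gt_max => /andP[ns nt].
    apply: le_trans (Hb n); apply: resolution_mono; apply: ltW.
      by apply: lt_le_trans ns _; rewrite ler_nat leq_addr.
    by apply: lt_le_trans nt _; rewrite ler_nat leq_addr.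
  - move=> n; have [b1 b2] := big n; have := Hy (n + N)%N.
    by rewrite PhiT // => H; apply: (le_sub_eq Gpo H); rewrite /g; abel.
have [m [mT m_ge0 mU m_sup mQ]] := vector_measure Gpo Gdir Gsigma Gint u0
  Phi_ge0 Phi_le Phi_mono Phi_volume Phi_left Phi_Ny Phi_xN Phi_total.
pose p0 : R * R := (s0, t0).
have bT := @borel2T R.
have m_mono A B : borel2 A -> borel2 B -> A `<=` B -> m A <= m B.
  move=> bA bB AB; have bD := borel2D bB bA.
  rewrite -(setDUK AB) mU // ?setDIK //.
  by apply: (le_sub_eq Gpo (m_ge0 _ bD)); abel.
have m_le A : borel2 A -> m A <= - gamma by move=> bA; rewrite -mT; exact: m_mono.
(* The mass (1, gamma) at the characteristic point is added back to m; the bound m A <= -gamma keeps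
   the result in E. *)
have /choice[x Hx] : forall A : set (R * R), exists e : perfect_ea G, borel2 A ->
    zpart e = (`[< A p0 >])%:Z /\ gpart e = m A + gamma *+ `[< A p0 >].
  move=> A; have [bA|nA] := pselect (borel2 A); last by exists ea0.
  have [Ap|nAp] := boolP `[< A p0 >].
    have [|e [e1 e2]] := @perfect_ex1 G (m A + gamma); last by exists e; rewrite mulr1n.
    by apply: (le_sub_eq Gpo (m_le _ bA)); abel.
  have [e [e1 e2]] := perfect_ex0 (m_ge0 _ bA).
  by exists e; rewrite mulr0n addr0.
exists x; split; last first.
  move=> s t; have [e1 e2] := Hx _ (borel2_quadrant s t).
  have in_p0 : `[< quadrant s t p0 >] = (s0 < s) && (t0 < t).
    by apply/asboolP/andP; rewrite /quadrant /= !in_itv.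
  apply: perfect_eq; first by rewrite e1 in_p0 resolution_zpart.
  by rewrite e2 in_p0 mQ /Phi subrK.
split.
- have [e1 e2] := Hx _ bT; rewrite asboolT // in e1 e2.
  by apply: perfect_eq; rewrite ?e1 // e2 mT mulr1n addNr.
- move=> A B bA bB AB0.
  have bU := borel2U bA bB.
  have [a1 a2] := Hx _ bA; have [b1 b2] := Hx _ bB; have [c1 c2] := Hx _ bU.
  have pU : `[< (A `|` B) p0 >] = (`[< A p0 >] + `[< B p0 >])%N :> nat.
    rewrite asbool_or; do 2 case: asboolP => //= ?; exfalso.
    by have : (A `&` B) p0 by []; rewrite AB0.
  rewrite /ea_add; suff -> : \val (x A) + \val (x B) = \val (x (A `|` B)) by rewrite valK.
  rewrite !val_perfect c1 c2 a1 a2 b1 b2 mU // pU PoszD mulrnDr.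
  rewrite -[LHS]/((_, _) : Zlex G); congr (_, _).
  by rewrite -[LHS]/(m A + gamma *+ `[< A p0 >] + (m B + gamma *+ `[< B p0 >])); abel.
- move=> A bA Ainc.
  have bU := borel2_bigcup bA.
  have [c1 c2] := Hx _ bU; have [mub mlub] := m_sup A bA Ainc.
  have mA i : m (A i) <= m (\bigcup_i A i) by apply: mub; exists i.
  split=> [_ [i _ <-]|b Hb].
    have [a1 a2] := Hx _ (bA i); rewrite le_perfect a1 a2 c1 c2.
    case: asboolP => Ap; case: asboolP => Up; rewrite /= ?mulr1n ?mulr0n ?addr0 //.
      exact: Gpo.
    by exfalso; apply: Up; exists i.
  have Hbi i : x (A i) <= b by apply: Hb; exists i.
  rewrite le_perfect c1 c2; case: asboolP => Up; last first.
    have a0 i : zpart (x (A i)) = 0 /\ gpart (x (A i)) = m (A i).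
      have [-> ->] := Hx _ (bA i); rewrite asboolF ?mulr0n ?addr0 // => Ap.
      by apply: Up; exists i.
    rewrite mulr0n addr0; have [[b0 _]|[-> //]] := perfect_cases b.
    rewrite b0 /=; apply: mlub => _ [i _ <-]; have [a0i <-] := a0 i.
    by apply: gpart_mono (Hbi i); rewrite a0i b0.
  (* From [A i0] on, all integer parts are 1, and G-parts can be compared with that of b; earlier
     sets are handled by monotonicity of m. *)
  have [i0 _ Ai0] := Up.
  have a1 i : (i0 <= i)%N -> zpart (x (A i)) = 1 /\ gpart (x (A i)) = m (A i) + gamma.
    move=> i0i; have [-> ->] := Hx _ (bA i); rewrite asboolT ?mulr1n //.
    by have /subsetPset := Ainc _ _ i0i; apply.
  have b1 : zpart b = 1.
    have [[b0 _]|[]//] := perfect_cases b.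
    by have := zpart_mono (Hbi i0); rewrite b0 (a1 i0 (leqnn _)).1.
  rewrite b1 mulr1n /=; suff H : m (\bigcup_i A i) <= gpart b - gamma.
    by apply: (le_sub_eq Gpo H); abel.
  apply: mlub => _ [i _ <-]; pose j := maxn i0 i.
  have [zj gj] := a1 j (leq_maxl _ _).
  have : gpart (x (A j)) <= gpart b by apply: gpart_mono (Hbi j); rewrite zj b1.
  rewrite gj => H; have H' : m (A i) <= m (A j).
    by apply: m_mono => //; apply/subsetPset/Ainc; exact: leq_maxr.
  by apply: (le_sub_eq Gpo (poD Gpo H H')); abel.
Qed.

End Resolution.

(** * Uniqueness *)

Lemma observable_unique (R : realType) (G : porderZmodType)
    (F : R * R -> perfect_ea G) (x y : set (R * R) -> perfect_ea G) :
  observable2 x -> observable2 y -> extends2 x F -> extends2 y F ->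
  forall A, borel2 A -> y A = x A.
Proof.
move=> [xT xD xU] [yT yD yU] xF yF.
(* The sum of E is partial, but in the ambient group it can be cancelled; thus the Borel sets where
   x and y agree are closed under proper differences and form a lambda-system. *)
have diffE (w : set (R * R) -> perfect_ea G) (A B : set (R * R)) :
    (forall A B : set (R * R), borel2 A -> borel2 B -> A `&` B = set0 ->
       ea_add (w A) (w B) = Some (w (A `|` B))) ->
    borel2 A -> borel2 B -> B `<=` A -> \val (w (A `\` B)) = \val (w A) - \val (w B).
  move=> wD bA bB BA; have := wD _ _ bB (borel2D bA bB) (setDIK _ _).
  by move=> /ea_add_val; rewrite setDUK // => ->; rewrite addrC addKr.
pose H := [set A : set (R * R) | borel2 A /\ y A = x A].
suff HA : <<s @rational_quadrants R >> `<=` H.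
  by move=> A /borel2_rational/HA[].
apply: (lambda_system_subset (@rational_quadrants_setI R)) => //; last first.
  move=> _ [q [r ->]]; split; first exact: borel2_quadrant.
  by rewrite (xF (ratr q) (ratr r)) (yF (ratr q) (ratr r)).
split => //.
- split; last by rewrite xT yT.
  exact: borel2T.
- move=> A B BA [bA eA] [bB eB]; split; first exact: borel2D.
  by apply: val_inj; rewrite !diffE // eA eB.
- move=> A Ainc HA; have bA i : borel2 (A i) by have [] := HA i.
  split; first exact: borel2_bigcup.
  have eA : (fun i => y (A i)) = (fun i => x (A i)).
    by apply/funext => i; have [] := HA i.
  have [xub xlub] := xU A bA Ainc; have [yub ylub] := yU A bA Ainc.
  rewrite eA in yub ylub.
  by apply/eqP; rewrite eq_le ylub // xlub.
Qed.

Theorem theorem1p6 (R : realType) (G : porderZmodType)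
    (Gpo : po_group G) (Gdir : directed G)
    (Gsigma : monotone_sigma_complete G) (Gint : interpolation G)
    (F : R * R -> perfect_ea G) (Fres : spectral_resolution2 F) :
  exists x : set (R * R) -> perfect_ea G,
    [/\ observable2 x, extends2 x F
      & forall y : set (R * R) -> perfect_ea G,
          observable2 y -> extends2 y F ->
          forall A : set (R * R), borel2 A -> y A = x A].
Proof.
have [x [xobs xF]] := resolution_observable Gpo Gdir Gsigma Fres Gint.
by exists x; split => // y yobs yF; exact: observable_unique.
Qed.
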